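(* There is a lonely point in $\omega^*$ if and only if there is a countable extremally disconnected OHI space $X$ with a remote point $p\in X^*$ of $X$ such that $p$ is a weak P-point of $X^*$.
   Context: All spaces considered are Tychonoff ($T_{3\frac12}$, including Hausdorff) and crowded (without isolated points), unless otherwise stated. $\beta X$ is the Čech–Stone compactification of $X$ and $X^*=\beta X\setminus X$; $\omega^*=\beta\omega\setminus\omega$, where $\omega$ is discrete (so $\omega^*$ is the space of free ultrafilters on $\omega$ with the Stone topology). A point $p$ is a limit point of a set $A$ if $p\in\overline{A\setminus\{p\}}$. A space is extremally disconnected if the closure of every open subset is open. A crowded space is irresolvable if it does not contain two disjoint dense subsets, and resolvable otherwise. A crowded space is open hereditarily irresolvable (OHI) if every nonempty open subspace is irresolvable. A point $p\in X^*$ is a remote point of $X$ if it is not a limit point (in $\beta X$) of any nowhere dense subset of $X$. A point $p$ of a space $Y$ is a weak P-point of $Y$ if it is not a limit point of any countable subset of $Y$. A point $p$ of a space $Y$ is lonely (in $Y$) if: (i) $p$ is not a limit point of any countable discrete subset of $Y$ (discrete in the subspace topology); (ii) $p$ is a limit point of some countable crowded subset of $Y$ (crowded in the subspace topology); (iii) whenever $p$ is a limit point of two countable subsets of $Y$, it is a limit point of their intersection. *)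

(* Defs.v *)
From HB Require Import structures.
From mathcomp Require Import all_boot all_order all_algebra.
From mathcomp Require Import all_classical all_reals all_analysis.

Set Implicit Arguments.
Unset Strict Implicit.
Unset Printing Implicit Defensive.

Import Order.TTheory GRing.Theory Num.Theory.
Import numFieldNormedType.Exports.

Local Open Scope classical_set_scope.
Local Open Scope ring_scope.

(* A subspace Y of a topological space T is represented by a set Y : set T.
   For p in Y and A `<=` Y, being a limit point of A, or an isolated point of
   A, means the same in Y as in T, so the ambient limit_point and isolated are
   used throughout. *)

Section Subspaces.
Context {T : topologicalType}.
Implicit Types (A U Y : set T) (p : T).

Definition crowded A := isolated A = set0.

Definition discrete_subset A := isolated A = A.

Definition dense_in U A := A `<=` U /\ U `<=` closure A.

Definition irresolvable U :=
  crowded U /\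
  ~ exists A B, [/\ dense_in U A, dense_in U B & A `&` B = set0].

Definition nowhere_dense A := interior (closure A) = set0.

Definition weak_P_point Y p :=
  Y p /\ forall A, A `<=` Y -> countable A -> ~ limit_point A p.

Definition lonely Y p :=
  [/\ Y p,
      forall A, A `<=` Y -> countable A -> discrete_subset A ->
        ~ limit_point A p,
      exists A, [/\ A `<=` Y, countable A, crowded A & limit_point A p]
    & forall A B, A `<=` Y -> B `<=` Y -> countable A -> countable B ->
        limit_point A p -> limit_point B p -> limit_point (A `&` B) p].

End Subspaces.

Section Spaces.
Variable X : topologicalType.

(* completely_regular_space is phrased with uniform separators; by
   uniform_separatorP this is separation by functions into [0, 1]. *)
Definition tychonoff_space := hausdorff_space X /\ completely_regular_space X.

Definition extremally_disconnected :=
  forall U : set X, open U -> open (closure U).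

Definition open_hereditarily_irresolvable :=
  crowded [set: X] /\
  forall U : set X, open U -> U !=set0 -> irresolvable U.

End Spaces.

(* The Cech-Stone compactification of a Tychonoff space X, as the closure of
   the image of X under the evaluation map into the Tychonoff cube indexed by
   all continuous functions from X to [0, 1]. The cube is contained in the
   product of copies of R, and the closure may be taken in that product. *)
Section CechStone.
Variables (R : realType) (X : topologicalType).

Definition unit_function : choiceType :=
  {classic {f : X -> R | continuous f /\ forall x, 0 <= f x <= 1}}.

Definition cech_stone_map : X -> prod_topology (fun _ : unit_function => R) :=
  join_product (fun f : unit_function => sval f).

Definition cech_stone : set (prod_topology (fun _ : unit_function => R)) :=
  closure (range cech_stone_map).

Definition cech_stone_remainder := cech_stone `\` range cech_stone_map.

Definition remote_point p :=
  cech_stone_remainder p /\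
  forall N : set X, nowhere_dense N -> ~ limit_point (cech_stone_map @` N) p.

End CechStone.

Arguments cech_stone_map : clear implicits.
Arguments cech_stone : clear implicits.
Arguments cech_stone_remainder : clear implicits.

(* Main.v *)
Require Import Defs.
From HB Require Import structures.
From mathcomp Require Import all_boot all_order all_algebra.
From mathcomp Require Import all_classical all_reals all_analysis.
From mathcomp Require Import wochoice.

Set Implicit Arguments.
Unset Strict Implicit.
Unset Printing Implicit Defensive.

Import Order.TTheory GRing.Theory Num.Theory.
Import numFieldNormedType.Exports.

Local Open Scope classical_set_scope.

(** Write [w*] for the remainder of [nat], whose points are the free ultrafilters
    on [nat].

    From a lonely point to a space. Let [p] be lonely in [w*] and let [A] be a
    countable crowded set accumulating at [p], with [p] itself removed. By Hewitt's
    decomposition [A] is covered by the closure of a subset that has two disjoint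
    dense subsets, together with an OHI part. That closure does not contain [p],
    because [p] would then be a limit of two disjoint countable sets, so the OHI
    part [Y] accumulates at [p] ([lonely_ohi_subspace]). Countable subspaces of [w*] are
    extremally disconnected ([separate_countable]). There is exactly one point [q]
    of the compactification of [Y] above [p], and both remoteness and the weak
    P-property of [q] again follow from the fact that disjoint countable sets do
    not accumulate together at [p] ([remote_of_lonely]).

    From a space to a lonely point. Let [p] be a remote point of [X] as in the
    theorem. In an OHI space sets with empty interior are nowhere dense, so that
    the sets whose closure contains [p] form an ultrafilter on the set [X]
    ([remote_trace_setI]). Embed [X] in [w*] so that the closure of the image is a
    weak P-set, and let [q] be the image of [p]. A countable subset of [w*]
    accumulating at [q] must do so through points of the image of [X]: the
    points outside the closure are excluded by the weak P-set property, and
    those in the remainder of [X] by the weak P-point property of [p]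
    ([limit_point_preimage]). On the image of [X], loneliness is the ultrafilter
    property together with remoteness, since discrete subsets of a crowded space
    are nowhere dense.

    The embedding is the substantial part ([weak_P_embedding_exists]). It is built
    in the way Kunen constructed weak P-points, from a matrix of subsets of [nat]
    with continuum many independent rows ([kunen_matrix_independent_linked]). By
    transfinite recursion a continuous family of filters [F x] is enlarged; at
    each stage countably many rows are consumed in order to decide a set
    ([decide]), to represent a clopen set of [X] ([represent]), or to make the
    closure of the family evade countable sets ([settle]). Extremal
    disconnectedness keeps the family continuous when a set is decided, and
    countability of [X] keeps the number of consumed rows small. *)

(** * Kunen's matrix *)

Definition prefix_tuple (x : set nat) k : k.-tuple bool := [tuple `[< x i >] | i < k].

Lemma prefix_tuple_neq (x y : set nat) : x != y ->
  exists k, forall j, (k <= j)%N -> prefix_tuple x j != prefix_tuple y j.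
Proof.
move=> /eqP xy; apply: contrapT => H; apply: xy.
apply/seteqP; suff aux (a b : set nat) : (a = x /\ b = y) \/ (a = y /\ b = x) -> a `<=` b.
  by split; apply: aux; [left|right].
move=> ab i ai; apply: contrapT => bi; apply: H; exists i.+1 => j ij.
apply/negP => /eqP e.
have := congr1 (fun t : j.-tuple bool => tnth t (Ordinal ij)) e; rewrite !tnth_mktuple /=.
by case: ab => -[<- <-]; rewrite (asboolT ai) (asboolF bi).
Qed.

Lemma prefix_tuple_inj (s : seq (set nat)) : exists k, forall j, (k <= j)%N ->
  {in s &, injective (prefix_tuple^~ j)}.
Proof.
elim: s => [|x s [k Hk]]; first by exists 0%N.
have [m Hm] : exists m, forall y, y \in s -> y != x -> forall j, (m <= j)%N ->
    prefix_tuple x j != prefix_tuple y j.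
  elim: s {k Hk} => [|z s [m Hm]]; first by exists 0%N.
  have [zx|zx] := eqVneq z x.
    exists m => y; rewrite inE => /orP[/eqP ->|]; last exact: Hm.
    by rewrite zx eqxx.
  have [m' Hm'] : exists k, forall j, (k <= j)%N -> prefix_tuple x j != prefix_tuple z j.
    by apply: prefix_tuple_neq; rewrite eq_sym.
  exists (maxn m m') => y; rewrite inE => /orP[/eqP -> _|ys yx] j; rewrite geq_max => /andP[].
    by move=> _ /Hm'.
  by move=> + _; exact: Hm.
exists (maxn k m) => j; rewrite geq_max => /andP[kj mj] y z.
rewrite !inE => /orP[/eqP ->|ys] /orP[/eqP ->|zs] // e.
- by have [//|zx] := eqVneq z x; have /eqP := Hm _ zs zx _ mj.
- by have [//|zx] := eqVneq y x; have /eqP := Hm _ ys zx _ mj; rewrite e.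
- exact: (Hk _ kj).
Qed.

(** A code is a finite approximation: at level [k] it prescribes, for each
    prefix of length [k] of a row, a finite set of prefixes of columns. *)
Definition kunen_code := {k : nat & {ffun k.-tuple bool -> {set k.-tuple bool}}}.

(** Kunen's matrix: a code lies in the entry of row [y], column [x] and width [n]
    when it prescribes for the prefix of [y] at most [n] prefixes, one of them
    that of [x]. Codes are turned into natural numbers by [pickle]. *)
Definition kunen_matrix (y x : set nat) (n : nat) : set nat :=
  [set pickle s | s in [set s : kunen_code |
    prefix_tuple x (tag s) \in tagged s (prefix_tuple y (tag s)) /\
    (#|tagged s (prefix_tuple y (tag s))| <= n)%N]].

Section LinkedMatrix.
Variables J K : choiceType.
Variable A : J -> K -> nat -> set nat.

(** A tile is an intersection inside one row, a cell one across rows; a list is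
    admissible if each of its tiles has at most as many columns as its width
    and its rows are distinct and not in the set [U] of consumed rows. *)
Definition tile (t : J * (nat * seq K)) := \bigcap_(x in [set` t.2.2]) A t.1 x t.2.1.
Definition cell (c : seq (J * (nat * seq K))) := \bigcap_(t in [set` c]) tile t.

Definition admissible (U : set J) (c : seq (J * (nat * seq K))) :=
  [/\ uniq (unzip1 c), {in c, forall t, (size t.2.2 <= t.2.1)%N}
    & {in c, forall t, ~ U t.1}].

(** In a row, [n] entries of width [n] may be intersected freely, but [n + 1] of
    them have finite intersection; between distinct rows there is complete
    independence. Finiteness lets uncountably many sets attached to one sequence
    escape countably many ultrafilters; independence keeps filters proper. *)
Definition independent_linked :=
  [/\ forall y x m n, (m <= n)%N -> A y x m `<=` A y x n,
      forall y n s, uniq s -> (n < size s)%N ->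
        finite_set (\bigcap_(x in [set` s]) A y x n)
    & forall c, admissible set0 c -> infinite_set (cell c)].

End LinkedMatrix.

Lemma bigcap_pickle (s : seq (set nat)) y n m :
  s != [::] -> (\bigcap_(x in [set` s]) kunen_matrix y x n) m ->
  exists2 c : kunen_code, m = pickle c & 
    forall x, x \in s -> prefix_tuple x (tag c) \in tagged c (prefix_tuple y (tag c)) /\
    (#|tagged c (prefix_tuple y (tag c))| <= n)%N.
Proof.
case: s => // x0 s _ H.
have [c _ cm] := H x0 (mem_head _ _); move: H; rewrite -{m}cm => H.
exists c => // x xs; have [c' Hc' /(pcan_inj (@pickleK _)) <-] := H _ xs.
exact: Hc'.
Qed.

(** From a level at which the prefixes of the [n + 1] columns are distinct, no set
    of at most [n] prefixes contains them all, and each lower level has finitely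
    many codes. *)
Lemma kunen_matrix_linked y n s : uniq s -> (n < size s)%N ->
  finite_set (\bigcap_(x in [set` s]) kunen_matrix y x n).
Proof.
move=> us ns.
have [k Hk] := prefix_tuple_inj s.
apply: (@sub_finite_set _ _ (\bigcup_(j in `I_k)
    [set pickle (Tagged (fun k => {ffun k.-tuple bool -> {set k.-tuple bool}}) f) |
      f in [set: {ffun j.-tuple bool -> {set j.-tuple bool}}]])); last first.
  by apply: bigcup_finite; [exact: finite_II|move=> j _; apply: finite_image; exact: finite_finset].
move=> m /bigcap_pickle[|c ->{m} Hc]; first by case: s us ns {Hk}.
case: c Hc => j f /= Hf; exists j; last by exists f.
rewrite /= ltnNge; apply/negP => kj.
have s0 : nth set0 s 0 \in s by rewrite mem_nth //; apply: leq_ltn_trans ns.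
have := (Hf _ s0).2; rewrite leqNgt => /negP; apply.
apply: leq_trans ns _.
rewrite -(size_map (prefix_tuple^~ j)).
have u : uniq [seq prefix_tuple x j | x <- s].
  by rewrite map_inj_in_uniq //; exact: Hk.
rewrite -(card_uniqP u); apply: subset_leq_card; apply/fintype.subsetP => a /mapP[x xs ->].
by have [] := Hf _ xs.
Qed.

(** At every level where the prefixes of the rows are distinct, the code [f] that
    prescribes for each row precisely the listed columns lies in the cell. *)
Lemma kunen_matrix_independent c : admissible set0 c -> infinite_set (cell kunen_matrix c).
Proof.
move=> [uc sc _].
have [k Hk] := prefix_tuple_inj (unzip1 c).
pose f j : {ffun j.-tuple bool -> {set j.-tuple bool}} := [ffun a =>
  \bigcup_(t <- c | prefix_tuple t.1 j == a) [set z in [seq prefix_tuple x j | x <- t.2.2]]]%SET.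
have Ef j t : (k <= j)%N -> t \in c -> f j (prefix_tuple t.1 j) =
    [set z in [seq prefix_tuple x j | x <- t.2.2]]%SET.
  move=> kj tc; rewrite ffunE (big_rem t) //= eqxx big_seq_cond big1 ?finset.setU0 //.
  move=> t' /andP[t'c /eqP e].
  have t'c' : t' \in c by apply: mem_rem t'c.
  have uc' : uniq c by exact: map_uniq uc.
  have e1 : t'.1 = t.1 by apply: (Hk j kj) => //; apply/mapP; [exists t'|exists t].
  move: t'c; rewrite (rem_filter _ uc') mem_filter => /andP[/= /negP []].
  have := uc => /(uniqP set0); rewrite size_map => inj.
  have h (s : set nat * (nat * seq (set nat))) : s \in c -> (index s c < size c)%N.
    by rewrite index_mem.
  have n1 (s : set nat * (nat * seq (set nat))) : s \in c -> nth set0 (unzip1 c) (index s c) = s.1.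
    by move=> sin; rewrite (nth_map s) ?h // nth_index.
  have := inj (index t' c) (index t c); rewrite !inE !h // !n1 // => /(_ erefl erefl e1) ii.
  by rewrite -(nth_index t t'c') ii nth_index.
pose g j : nat := pickle (Tagged (fun k => {ffun k.-tuple bool -> {set k.-tuple bool}}) (f j)).
have g_inj : injective g.
  by move=> i j /(pcan_inj (@pickleK _)) /(congr1 (@tag _ _)).
have : infinite_set [set g j | j in [set j | (k <= j)%N]].
  move=> fin; apply: infinite_nat.
  have : finite_set [set j | (k <= j)%N].
    have := finite_image (fun m => xget 0%N [set j | g j = m]) fin.
    apply: sub_finite_set => j kj; exists (g j); first by exists j.
    by case: xgetP => [i _ /g_inj ->|/(_ j)/(_ erefl)].
  move=> fink; have : finite_set (`I_k `|` [set j | (k <= j)%N]).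
    by rewrite finite_setU; split => //; exact: finite_II.
  apply: sub_finite_set => j _.
  by have [?|?] := leqP k j; [right|left].
apply: sub_infinite_set => _ [j kj <-] t /= tc x /= xt.
exists (Tagged (fun k => {ffun k.-tuple bool -> {set k.-tuple bool}}) (f j)) => //=.
rewrite (Ef _ _ kj tc) !inE; split; first by apply/mapP; exists x.
apply: leq_trans (sc _ tc); rewrite cardsE.
by rewrite (leq_trans (card_size _)) // size_map.
Qed.

Lemma kunen_matrix_independent_linked : independent_linked kunen_matrix.
Proof.
split; [|exact: kunen_matrix_linked|exact: kunen_matrix_independent].
move=> y x m n mn _ [s [xs sm] <-]; exists s => //; split=> //; exact: leq_trans mn.
Qed.

(** * A well-order with small initial segments *)

Definition strict_well_order (Q : Type) (lt : Q -> Q -> Prop) :=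
  [/\ well_founded lt, forall a b c, lt a b -> lt b c -> lt a c
    & forall a b, [\/ lt a b, a = b | lt b a]].

Lemma strict_well_order_exists (J : choiceType) :
  exists lt : J -> J -> Prop, strict_well_order lt.
Proof.
have [R woR] := well_ordering_principle J.
have chR : wo_chain R predT by move=> A _; exact: woR.
have totR a b : R a b \/ R b a by apply/orP; exact: (wo_chainW chR).
have antiR a b : R a b -> R b a -> a = b.
  by move=> ab ba; apply: (wo_chain_antisymmetric chR) => //; rewrite ab ba.
exists (fun a b => ~ R b a).
have wfR : well_founded (fun a b => ~ R b a).
  move=> a; apply: contrapT => Na.
  have [|z [[/asboolP Nz lb] _]] := woR (fun x => `[< ~ Acc (fun a b => ~ R b a) x >]).
    by exists a; apply/asboolP.
  apply: Nz; constructor => y zy; apply: contrapT => Ny.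
  by apply: zy; apply: lb; apply/asboolP.
have asym a b : ~ R b a -> ~ R a b -> False by have [] := totR a b.
have tri a b : [\/ ~ R b a, a = b | ~ R a b].
  have [ab|nab] := pselect (R a b); last by apply: Or33.
  have [ba|nba] := pselect (R b a); last by apply: Or31.
  by apply: Or32; exact: antiR.
split => // a b c ab bc; have [//|ac|ca] := tri a c.
  by rewrite ac in ab; case: (asym _ _ ab bc).
(* a 3-cycle has no least element *)
exfalso; elim: (wfR a) b c ab bc ca => x _ IH b c xb bc cx.
exact: (IH _ cx x b cx xb bc).
Qed.

Section Stages.
Variable J : choiceType.
Hypothesis uncountableJ : ~ countable [set: J].


(** This replaces the well-order of type the continuum: countably many rows
    consumed at each earlier stage never exhaust [J]. Call a set of indices large
    if countably many elements of [J] per index suffice to cover [J]. A minimal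
    large initial segment [D] has no large proper initial segment, and
    [D * nat], ordered lexicographically, maps onto [J]. This avoids cardinal
    arithmetic. *)
Lemma stages_exist : exists (Q : Type) (lt : Q -> Q -> Prop) (g : Q -> J),
  [/\ strict_well_order lt, forall j, exists q, g q = j
    & forall q (f : Q -> nat -> J),
        exists j, forall q' n, lt q' q -> f q' n <> j].
Proof.
have [lt0 [wf0 tr0 tri0]] := strict_well_order_exists J.
pose large (D : set J) := exists f : J -> nat -> J,
  forall j : J, exists d n, D d /\ f d n = j.
have [D [lD sD]] : exists D, large D /\ forall d, D d -> ~ large [set s | lt0 s d].
  have [[t]|N] := pselect (exists t, large [set s | lt0 s t]); last first.
    exists setT; split; first by exists (fun d _ => d) => j; exists j, 0%N.
    by move=> d _ ld; apply: N; exists d.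
  elim: (wf0 t) => {}t _ IH lt.
  have [[s [st ls]]|N] := pselect (exists s, lt0 s t /\ large [set r | lt0 r s]).
    exact: IH ls.
  exists [set s | lt0 s t]; split => // d dt ld; apply: N; by exists d.
have [g Hg] := lD.
pose Q := ({d : J | D d} * nat)%type.
pose lt (a b : Q) := lt0 (sval a.1) (sval b.1) \/ (sval a.1 = sval b.1 /\ (a.2 < b.2)%N).
exists Q, lt, (fun q => g (sval q.1) q.2); split; last first.
- move=> [[d Dd] m] f; apply: contrapT => N; apply: (sD d Dd).
  have {N} cov j : exists q' n, lt q' (exist _ d Dd, m) /\ f q' n = j.
    apply: contrapT => Nj; apply: N; exists j => q' n l e.
    by apply: Nj; exists q', n.
  have [[s0 s0d]|Nlt] := pselect (exists s, lt0 s d); last first.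
    exfalso; apply: uncountableJ.
    pose F (k : nat * nat) := f (exist _ d Dd, k.1) k.2.
    have -> : [set: J] = [set F k | k in [set: nat * nat]].
      apply/seteqP; split => // j _; have [[[d' Dd'] n'] [n [l <-]]] := cov j.
      case: l => /= [l|[e _]]; first by case: Nlt; exists d'.
      exists (n', n) => //; rewrite /F /=; congr (f (_, _) _).
      by apply: eq_exist.
    by apply: sub_countable (card_image_le _ _) _; exact: countableP.
  (* the countable part contributed by d itself is moved to the index s0 *)
  pose f' (s : J) (k : nat) : J := match unpickle k with
    | Some (inl (m', i)) => if pselect (D s) is left Ds then f (exist _ s Ds, m') i else s
    | Some (inr (m', i)) => f (exist _ d Dd, m') i
    | None => s end.
  exists f' => j; have [[[d' Dd'] n'] [n [l <-]]] := cov j.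
  case: l => /= [l|[e _]].
    exists d', (pickle (inl (n', n) : (nat * nat + nat * nat)%type)); split => //.
    rewrite /f' pickleK; case: pselect => // Ds; congr (f (_, _) _).
    exact: eq_exist.
  exists s0, (pickle (inr (n', n) : (nat * nat + nat * nat)%type)); split => //.
  rewrite /f' pickleK; congr (f (_, _) _); exact: eq_exist.
- by move=> j; have [d [n [Dd <-]]] := Hg j; exists (exist _ d Dd, n).
split.
- move=> [[d Dd] m].
  elim: (wf0 d) Dd m => {}d _ IHd Dd m.
  elim/ltn_ind: m => m IHm; constructor => -[[d' Dd'] m'] [/= l|/= [e l]].
    exact: IHd.
  subst d'; have -> : Dd' = Dd by exact: Prop_irrelevance.
  exact: IHm.
- move=> [[a Da] i] [[b Db] j] [[c Dc] k]; rewrite /lt /=.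
  move=> [ab|[-> ij]] [bc|[<- jk]]; [left; exact: tr0 bc|by left|by left|right].
  by split => //; exact: ltn_trans jk.
- move=> [[a Da] i] [[b Db] j]; rewrite /lt /=.
  have [ab|ab|ba] := tri0 a b; [by apply: Or31; left| |by apply: Or33; left].
  subst b; have -> : Db = Da by exact: Prop_irrelevance.
  have [ij|ij|->] := ltngtP i j; [by apply: Or31; right|by apply: Or33; right|by apply: Or32].
Qed.
End Stages.

Lemma uncountable_set_nat : ~ countable [set: set nat].
Proof.
move=> /countable_injP[f finj].
pose d : set nat := [set n | exists2 x, f x = n & ~ x n].
have e : d (f d) <-> ~ d (f d).
  split; last by exists d.
  by move=> [x fx xN]; have xd : x = d by [apply: finj; rewrite ?inE]; rewrite xd in xN.
by have := e; tauto.
Qed.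

(** * Continuous families of filters *)

Lemma open_constant (X : topologicalType) (P : Prop) : open [set x : X | P].
Proof.
have [p|p] := pselect P.
  by rewrite (_ : [set _ | _] = setT); [exact: openT|apply/seteqP; split].
by rewrite (_ : [set _ | _] = set0); [exact: open0|apply/seteqP; split].
Qed.

Section Families.
Variables (X : topologicalType) (J K : choiceType) (A : J -> K -> nat -> set nat).
Hypothesis A_il : independent_linked A.

(** An approximation to the embedding: filters [F x] that depend continuously on
    [x], modulo which the rows outside [U] are still independent. *)
Definition coherent (F : X -> set_system nat) (U : set J) :=
  [/\ forall x, Filter (F x),
      forall x Y, finite_set (~` Y) -> F x Y,
      forall Y, open [set x | F x Y]
    & forall x Y c, F x Y -> admissible U c -> (Y `&` cell A c) !=set0].

Definition extend (F G : X -> set_system nat) (x : X) : set_system nat :=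
  [set B | exists Y g, [/\ F x Y, G x g & Y `&` g `<=` B]].

Lemma sub_extend (F G : X -> set_system nat) : (forall x, G x setT) ->
  forall x, F x `<=` extend F G x.
Proof. by move=> GT x Y FY; exists Y, setT; split => //; rewrite setIT. Qed.

Lemma extend_gen F G x g : Filter (F x) -> G x g -> extend F G x g.
Proof. by move=> FF Gg; exists setT, g; split => //; exact: filterT. Qed.

Lemma coherent_extend F G U V : coherent F U ->
  (forall x, G x setT) ->
  (forall x a b, G x a -> G x b -> G x (a `&` b)) ->
  (forall g, open [set x | G x g]) ->
  (forall x Y g c, F x Y -> G x g -> admissible V c ->
     (Y `&` g `&` cell A c) !=set0) ->
  coherent (extend F G) V.
Proof.
move=> [FF Fcof Fo _] GT GI Go Gind; split.
- move=> x; split.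
  + by apply: sub_extend => //; exact: filterT.
  + move=> B C [Y [g [FY Gg B1]]] [Y' [g' [FY' Gg' B2]]].
    exists (Y `&` Y'), (g `&` g'); split; [exact: filterI|exact: GI|].
    by rewrite setIACA => m [/B1 ? /B2].
  + by move=> B C BC [Y [g [FY Gg B1]]]; exists Y, g; split => // m /B1 /BC.
- by move=> x Y /(Fcof x) FY; exact: sub_extend.
- move=> B.
  have -> : [set x | extend F G x B] = \bigcup_(i in [set i : set nat * set nat |
      i.1 `&` i.2 `<=` B]) ([set x | F x i.1] `&` [set x | G x i.2]).
    apply/seteqP; split => x /=; first by move=> [Y [g [? ? ?]]]; exists (Y, g).
    by move=> [[Y g] /= ? [? ?]]; exists Y, g.
  by apply: bigcup_open => i _; apply: openI.
- move=> x B c [Y [g [FY Gg sB]]] ad.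
  by have [m [/sB ? ?]] := Gind _ _ _ _ FY Gg ad; exists m.
Qed.

Lemma coherent_bigcup (I : Type) (D : set I) (F : I -> X -> set_system nat)
    (U : I -> set J) : D !=set0 ->
  (forall i j, D i -> D j ->
    (forall x, F i x `<=` F j x) \/ (forall x, F j x `<=` F i x)) ->
  (forall i, D i -> coherent (F i) (U i)) ->
  coherent (fun x => \bigcup_(i in D) F i x) (\bigcup_(i in D) U i).
Proof.
move=> [i0 Di0] ch coh; split.
- move=> x; split.
  + by exists i0 => //; have [FF _ _ _] := coh _ Di0; exact: filterT.
  + move=> B C [i Di FB] [j Dj FC].
    have [FFi _ _ _] := coh _ Di; have [FFj _ _ _] := coh _ Dj.
    have [ij|ji] := ch _ _ Di Dj; [exists j => //|exists i => //].
      by apply: filterI => //; exact: ij.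
    by apply: filterI => //; exact: ji.
  + move=> B C BC [i Di FB]; exists i => //; have [FFi _ _ _] := coh _ Di.
    exact: filterS FB.
- by move=> x Y fY; exists i0 => //; have [_ cof _ _] := coh _ Di0; exact: cof.
- move=> Y; rewrite (_ : [set x | _] = \bigcup_(i in D) [set x | F i x Y]).
    by apply: bigcup_open => i Di; have [_ _ o _] := coh _ Di.
  by apply/seteqP; split => x.
- move=> x Y c [i Di FY] [uc sc Uc]; have [_ _ _ ind] := coh _ Di.
  by apply: (ind x) => //; split => // t tc Ut; apply: (Uc _ tc); exists i.
Qed.

Lemma coherent_cofinite : coherent (fun=> [set Y | finite_set (~` Y)]) set0.
Proof.
split => //.
- move=> x; split.
  + by rewrite /= setCT; exact: finite_set0.
  + by move=> B C /= fB fC; rewrite setCI finite_setU.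
  + by move=> B C /= BC; apply: sub_finite_set; exact: subsetC.
- by move=> Y; exact: open_constant.
- move=> x Y c /= fY ad; have [_ _ ind] := A_il.
  have inf : infinite_set ((cell A c `&` ~` Y) `|` (cell A c `&` Y)).
    by rewrite -setIUr setvU setIT; exact: ind.
  apply: contrapT => /nonemptyPn YC; apply: inf.
  by rewrite finite_setU; split; [exact: finite_setIr|rewrite setIC YC].
Qed.

Lemma cell_cat c d : cell A (c ++ d) = cell A c `&` cell A d.
Proof.
apply/seteqP; split => m H.
  by split => t /= tc; apply: H; rewrite /= mem_cat tc ?orbT.
by move=> t /=; rewrite mem_cat => /orP[]; [apply: H.1|apply: H.2].
Qed.

Lemma cell_cons t c : cell A (t :: c) = tile A t `&` cell A c.
Proof.
rewrite -cat1s cell_cat; congr (_ `&` _); apply/seteqP; split => m.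
  by apply; rewrite /= mem_head.
by move=> H t' /=; rewrite inE => /eqP ->.
Qed.

Lemma admissible_cat (U V : set J) (c d : seq (J * (nat * seq K))) :
  admissible U c -> admissible (U `|` V) d ->
  (forall t, t \in c -> V t.1) -> admissible U (c ++ d).
Proof.
move=> [uc sc Uc] [ud sd Ud] cV; split.
- rewrite /unzip1 map_cat cat_uniq uc ud andbT /=; apply/hasPn => _ /mapP[t td ->].
  by apply/mapP => -[t' /cV + e]; rewrite -e => Vt; apply: (Ud _ td); right.
- by move=> t; rewrite mem_cat => /orP[/sc|/sd].
- by move=> t; rewrite mem_cat => /orP[/Uc //|/Ud h] Ut; apply: h; left.
Qed.

Lemma admissible_cons (U : set J) t n (s : seq K) c : admissible (U `|` [set t]) c -> ~ U t ->
  (size s <= n)%N -> admissible U ((t, (n, s)) :: c).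
Proof.
move=> ad Ut sn; rewrite -cat1s; apply: (admissible_cat (V := [set t])) => //.
  by split => // t'; rewrite inE => /eqP ->.
by move=> t'; rewrite inE => /eqP ->.
Qed.

Lemma admissible_nil U : @admissible J K U [::]. Proof. by split. Qed.

Lemma admissibleW (U V : set J) (c : seq (J * (nat * seq K))) : U `<=` V ->
  admissible V c -> admissible U c.
Proof. by move=> UV [uc sc Vc]; split => // t /Vc + /UV. Qed.

Section Decide.
Hypotheses (cX : countable [set: X]) (edX : extremally_disconnected X).

(** Let [O] be the set of points at which some cell is incompatible with [Y]. On [O]
    the complement of [Y] can be added once the rows of that cell are given up,
    since it contains the cell. By continuity it can also be added on the closure
    of [O], which is open because [X] is extremally disconnected; off the closure
    [Y] itself can be added. As [X] is countable, countably many rows are lost. *)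
Lemma decide F U Y : coherent F U -> exists F' N,
  [/\ countable N, coherent F' (U `|` N), forall x, F x `<=` F' x,
      forall x, F' x Y \/ F' x (~` Y)
    & forall x c V, admissible U c -> F x V -> V `&` Y `&` cell A c = set0 ->
        F' x (~` Y)].
Proof.
move=> cF; have [FF _ Fo Find] := cF.
pose C x := [set c | admissible U c /\ exists2 V, F x V & V `&` Y `&` cell A c = set0].
pose O := [set x | C x !=set0].
pose cx x := xget [::] (C x).
pose N := \bigcup_x [set` unzip1 (cx x)].
have oO : open O.
  rewrite (_ : O = \bigcup_(i in [set i : _ * set nat | admissible U i.1 /\
      i.2 `&` Y `&` cell A i.1 = set0]) [set x | F x i.2]).
    by apply: bigcup_open.
  apply/seteqP; split => x; first by move=> [c [ad [V FV e]]]; exists (c, V).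
  by move=> [[c V] /= [ad e] FV]; exists c; split => //; exists V.
pose G x : set_system nat := [set g | [\/ g = setT,
  closure O x /\ g = ~` Y | ~ closure O x /\ g = Y]].
have GT x : G x setT by apply: Or31.
exists (extend F G), N; split.
- apply: bigcup_countable; first exact: cX.
  by move=> x _; apply: finite_set_countable; exact: finite_seq.
- apply: (coherent_extend cF) => //.
  + move=> x a b; case=> [->|[Ox ->]|[Ox ->]].
    * by rewrite setTI.
    * by case=> [->|[_ ->]|[]] //; rewrite ?setIT ?setIid; apply: Or32.
    * by case=> [->|[]|[_ ->]] //; rewrite ?setIT ?setIid; apply: Or33.
  + move=> g; rewrite (_ : [set x | _] = [set x | g = setT] `|`
        (closure O `&` [set x | g = ~` Y]) `|` (~` closure O `&` [set x | g = Y])).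
      apply: openU; first apply: openU.
      * exact: open_constant.
      * by apply: openI; [exact: edX|exact: open_constant].
      * apply: openI; last exact: open_constant.
        by apply: closed_openC; exact: closed_closure.
    apply/seteqP; split => x; first by case=> [?|?|?]; [left; left|left; right|right].
    by case=> [[?|?]|?]; [exact: Or31|exact: Or32|exact: Or33].
  + have onO x V d : O x -> F x V -> admissible (U `|` N) d ->
        (V `&` ~` Y `&` cell A d) !=set0.
      move=> Ox FV ad; have [adx [V' FV' e]] : C x (cx x).
        by case: Ox => c Cc; exact: xgetI Cc.
      have adcat : admissible U (cx x ++ d).
        apply: admissible_cat ad _ => // t tc; exists x => //.
        by apply/mapP; exists t.
      have [m [[Vm V'm]]] := Find x _ _ (filterI FV FV') adcat.
      rewrite cell_cat => -[cm dm]; exists m; split => //; split => // Ym.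
      have : (V' `&` Y `&` cell A (cx x)) m by []; by rewrite e.
    have onS x V d : F x V -> admissible (U `|` N) d -> (V `&` cell A d) !=set0.
      move=> FV ad; apply: (Find x) => //.
      by apply: admissibleW ad => j; left.
    move=> x V g d FV [->|[Ox ->]|[Ox ->]] ad.
    * by rewrite setIT; exact: onS FV ad.
    * have [y [Oy Fy]] : (O `&` [set y | F y V]) !=set0.
        by apply: Ox; apply: open_nbhs_nbhs; split.
      exact: onO Fy ad.
    * apply: contrapT => /nonemptyPn e; apply: Ox; apply: subset_closure.
      exists d; split; last by exists V.
      by apply: admissibleW ad => j; left.
- exact: sub_extend.
- move=> x; have [Ox|Ox] := pselect (closure O x); [right|left].
    by apply: extend_gen; apply: Or32.
  by apply: extend_gen; apply: Or33.
- move=> x c V ad FV e; apply: extend_gen; apply: Or32; split => //.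
  by apply: subset_closure; exists c; split => //; exists V.
Qed.

(** Either [W] is not a sequence of neighbourhoods of the closure of the family, or
    [K]-many neighbourhoods are attached to it such that any [n] of them meet
    inside [W n] up to a finite set: Kunen's OK property. *)
Definition settles (F : X -> set_system nat) (W : nat -> set nat) :=
  (exists x n, F x (~` W n)) \/
  exists V : K -> set nat, (forall a x, F x (V a)) /\
    forall s, uniq s -> s != [::] ->
      finite_set ((\bigcap_(a in [set` s]) V a) `\` W (size s)).

(** Unless some [W n] can be excluded at some point, all of them can be added,
    together with the sets [V a] that follow, on the part where the sequence stops
    at [n], the entry of width [n] of the column [a] in a fresh row. *)
Lemma settle F U t W : coherent F U -> ~ U t ->
  (forall m n, (m <= n)%N -> W n `<=` W m) -> \bigcap_n W n = set0 ->
  exists F' N,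
  [/\ countable N, coherent F' (U `|` N), forall x, F x `<=` F' x & settles F' W].
Proof.
move=> cF Ut Wd W0.
have [[x [n [c [V [ad FV e]]]]]|N] := pselect (exists x n c V,
    [/\ admissible U c, F x V & V `&` W n `&` cell A c = set0]).
  have [F' [N [cN cF' sF _ dF]]] := decide (W n) cF.
  exists F', N; split => //; left; exists x, n.
  exact: (dF x c V).
have [Amono Alink _] := A_il.
pose V a := \bigcup_n (A t a n `&` (W n `\` W n.+1)).
pose G (x : X) : set_system nat := [set g | exists n (s : seq K),
  W n `&` (\bigcap_(a in [set` s]) V a) `<=` g].
(* otherwise m would lie in all the W k, whose intersection is empty *)
have leave n m : W n m -> exists2 k, (n <= k)%N & (W k `\` W k.+1) m.
  move=> Wm; apply: contrapT => Nk.
  have H k : W (n + k)%N m.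
    elim: k => [|k IH]; first by rewrite addn0.
    apply: contrapT; rewrite addnS => h; apply: Nk.
    by exists (n + k)%N; rewrite ?leq_addr.
  suff : (\bigcap_n W n) m by rewrite W0.
  by move=> k _; apply: (Wd _ _ (leq_addl n k)).
have VW n a : W n `&` A t a n `<=` V a.
  move=> m [/leave[k nk Wk] Am]; exists k => //; split => //.
  exact: Amono nk _ Am.
exists (extend F G), [set t]; split.
- exact: countable1.
- apply: (coherent_extend cF).
  + by move=> x; exists 0%N, [::].
  + move=> x a b [n [s ha]] [n' [s' hb]]; exists (maxn n n'), (s ++ s').
    move=> m [Wm Vm]; split; [apply: ha|apply: hb]; split.
    * by apply: (Wd _ (maxn n n')) => //; exact: leq_maxl.
    * by move=> k /= ks; apply: Vm; rewrite /= mem_cat ks.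
    * by apply: (Wd _ (maxn n n')) => //; exact: leq_maxr.
    * by move=> k /= ks; apply: Vm; rewrite /= mem_cat ks orbT.
  + by move=> g; exact: open_constant.
  + move=> x Y g c FY [n [s sg]] ad.
    pose M := maxn n (size s).
    have ad' : admissible U ((t, (M, s)) :: c).
      by apply: admissible_cons => //; exact: leq_maxr.
    have [m [[Ym Wm]]] : (Y `&` W M `&` cell A ((t, (M, s)) :: c)) !=set0.
      apply: contrapT => /nonemptyPn e; apply: N.
      by exists x, M, ((t, (M, s)) :: c), Y.
    rewrite cell_cons => -[/= tm cm]; exists m; split => //; split => //.
    apply: sg; split; first by apply: Wd Wm; exact: leq_maxl.
    by move=> a /= sa; apply: (VW M); split => //; exact: tm.
- by apply: sub_extend => x; exists 0%N, [::].
- right; exists V; split.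
    move=> a x; apply: extend_gen; first by have [] := cF.
    by exists 0%N, [:: a] => m [_ /(_ a)]; apply; rewrite /= mem_head.
  case=> // a s us _.
  apply: (@sub_finite_set _ _ (\bigcup_(n in `I_(size (a :: s)))
      \bigcap_(a in [set` a :: s]) A t a n)); last first.
    apply: bigcup_finite; first exact: finite_II.
    by move=> n ns; exact: Alink.
  move=> m [Vm Wm].
  have [n _ [An [Wn WnS]]] : V a m by apply: Vm; rewrite /= mem_head.
  exists n => /=.
    by rewrite ltnNge; apply/negP => sn; apply: Wm; apply: Wd Wn.
  move=> b /= bs; have [k _ [Ak [Wk WkS]]] := Vm b bs.
  suff -> : n = k by [].
  by apply/eqP; rewrite eqn_leq; apply/andP; split; rewrite leqNgt; apply/negP => lt;
    [apply: WkS; apply: Wd Wn|apply: WnS; apply: Wd Wk].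
Qed.

End Decide.
End Families.

(** * Transfinite construction of the embedding *)

Lemma countable_enum (T : Type) (N : set T) : countable N -> N !=set0 ->
  exists f : nat -> T, N = range f.
Proof. by move=> /pfcard_geP[-> /set0P/eqP//|/surjfunPex]. Qed.

Section Transfinite.
Variables (X : topologicalType) (J K : choiceType) (A : J -> K -> nat -> set nat).
Hypothesis A_il : independent_linked A.

(** Two columns of width 1 of one row are almost disjoint; adding one of them on [Z]
    and the other one off [Z] makes [Z] the trace of the first. *)
Lemma represent (F : X -> set_system nat) (U : set J) t Z (a0 a1 : K) :
  coherent A F U -> ~ U t -> clopen Z ->
  a0 != a1 -> exists F' N,
  [/\ countable N, coherent A F' (U `|` N), forall x, F x `<=` F' x &
    exists Y, forall x, (Z x -> F' x Y) /\ (~ Z x -> F' x (~` Y))].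
Proof.
move=> cF Ut [oZ cZ] a01; have [FF Fcof _ Find] := cF.
pose G x : set_system nat := [set g | (Z x /\ A t a0 1%N `<=` g) \/
  (~ Z x /\ A t a1 1%N `<=` g)].
have GT x : G x setT by have [Zx|Zx] := pselect (Z x); [left|right].
have [Amono Alink _] := A_il.
have cF' : coherent A (extend F G) (U `|` [set t]).
  apply: (coherent_extend cF) => //.
  - move=> x a b [[Zx h]|[Zx h]] [[Zx' h']|[Zx' h']] //; [left|right];
      by split => // m Am; split; [exact: h|exact: h'].
  - move=> g; rewrite (_ : [set x | _] = (Z `&` [set x | A t a0 1%N `<=` g]) `|`
        (~` Z `&` [set x | A t a1 1%N `<=` g])); last by apply/seteqP; split.
    by apply: openU; apply: openI; rewrite ?openC //; exact: open_constant.
  - move=> x Y g c FY Gg ad.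
    have [a ag] : exists a, A t a 1%N `<=` g by case: Gg => -[_ ?]; [exists a0|exists a1].
    have [m [Ym]] := Find x _ _ FY (admissible_cons (n := 1%N) (s := [:: a]) ad Ut isT).
    rewrite cell_cons => -[/= tm cm]; exists m; split => //; split => //; apply: ag.
    by apply: tm; rewrite /= mem_head.
exists (extend F G), [set t]; split => //.
- exact: sub_extend.
- exists (A t a0 1%N) => x; split => Zx.
    by apply: extend_gen; left; split.
  have [FF' Fcof' _ _] := cF'; have FFx := FF' x.
  have F1 : extend F G x (A t a1 1%N) by apply: extend_gen; right; split.
  have F2 : extend F G x (~` (A t a0 1%N `&` A t a1 1%N)).
    apply: Fcof'; rewrite setCK.
    have : finite_set (\bigcap_(a in [set` [:: a0; a1]]) A t a 1%N).
      by apply: Alink => //=; rewrite inE a01.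
    apply: sub_finite_set => m [m0 m1] a /=.
    by rewrite !inE => /orP[/eqP ->|/eqP ->].
  apply: filterS (filterI F1 F2) => m [m1 m01] m0; exact: m01.
Qed.

Hypotheses (cX : countable [set: X]) (edX : extremally_disconnected X).
Variables (j0 : J) (a0 a1 : K).
Hypothesis a01 : a0 != a1.

(** The three kinds of requirements: decide a subset of [nat], settle a sequence,
    represent a clopen set. *)
Definition task := (set nat + ((nat -> set nat) + set X))%type.

Definition fulfills (T : task) (F : X -> set_system nat) : Prop :=
  match T with
  | inl Y => forall x, F x Y \/ F x (~` Y)
  | inr (inl W) => (forall m n, (m <= n)%N -> W n `<=` W m) ->
      \bigcap_n W n = set0 -> settles K F W
  | inr (inr Z) => clopen Z ->
      exists Y, forall x, (Z x -> F x Y) /\ (~ Z x -> F x (~` Y))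
  end.

Lemma fulfillsW T (F F' : X -> set_system nat) : (forall x, F x `<=` F' x) ->
  fulfills T F -> fulfills T F'.
Proof.
move=> sF; case: T => [Y|[W|Z]] /=.
- by move=> H x; have [?|?] := H x; [left|right]; exact: sF.
- move=> H /H{}H /H [[x [n h]]|[V [h1 h2]]]; first by left; exists x, n; exact: sF.
  by right; exists V; split => // a x; exact: sF.
- move=> H /H [Y hY]; exists Y => x; have [h1 h2] := hY x.
  by split => [/h1|/h2] h; exact: sF.
Qed.

Lemma fulfill_one (T : task) F U t : coherent A F U -> ~ U t -> exists F' N,
  [/\ countable N, coherent A F' (U `|` N), forall x, F x `<=` F' x & fulfills T F'].
Proof.
move=> cF Ut; case: T => [Y|[W|Z]] /=.
- by have [F' [N [? ? ? ? _]]] := decide cX edX Y cF; exists F', N.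
- have [h|h] := pselect ((forall m n, (m <= n)%N -> W n `<=` W m) /\ \bigcap_n W n = set0).
    by have [F' [N [? ? ? ?]]] := settle A_il cX edX cF Ut h.1 h.2; exists F', N; split.
  by exists F, set0; rewrite setU0; split => [||x Y|h1 h2] //; case: h.
- have [h|h] := pselect (clopen Z).
    by have [F' [N [? ? ? ?]]] := represent cF Ut h a01; exists F', N; split.
  by exists F, set0; rewrite setU0; split => [||x Y|/h] //.
Qed.

Definition state := ((X -> set_system nat) * set J)%type.

Lemma step_exists : exists step : task -> state -> state, forall T s t,
  coherent A s.1 s.2 -> ~ s.2 t ->
  [/\ countable (step T s).2, coherent A (step T s).1 (s.2 `|` (step T s).2),
      forall x, s.1 x `<=` (step T s).1 x & fulfills T (step T s).1].
Proof.
have /choice[f Hf] : forall Ts : task * state, exists s' : state,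
    (exists t, coherent A Ts.2.1 Ts.2.2 /\ ~ Ts.2.2 t) ->
  [/\ countable s'.2, coherent A s'.1 (Ts.2.2 `|` s'.2),
      forall x, Ts.2.1 x `<=` s'.1 x & fulfills Ts.1 s'.1].
  move=> -[T [F U]] /=.
  have [[t [cF Ut]]|h] := pselect (exists t, coherent A F U /\ ~ U t).
    by have [F' [N H]] := fulfill_one T cF Ut; exists (F', N).
  by exists (F, U) => h'; case: h.
by exists (fun T s => f (T, s)) => T s t cs st; apply: (Hf (T, s)); exists t.
Qed.

Section Recursion.
Variables (Q : Type) (lt : Q -> Q -> Prop).
Hypothesis wo : strict_well_order lt.
Variables (job : Q -> task) (step : task -> state -> state).

(** The cofinite sets are put in so that the first stage, which has no
    predecessor, starts from the Frechet filter. *)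
Definition gather (D : set Q) (st : Q -> state) : state :=
  (fun x => [set Y | finite_set (~` Y) \/ exists2 r, D r & (st r).1 x Y],
   \bigcup_(r in D) (st r).2).

Lemma recursion : exists st : Q -> state,
  forall q, st q = step (job q) (gather [set r | lt r q] st).
Proof.
have [wf _ _] := wo.
pose body q (rec : forall r, lt r q -> state) : state :=
  step (job q) (fun x => [set Y | finite_set (~` Y) \/
      exists r (h : lt r q), (rec r h).1 x Y],
    [set j | exists r (h : lt r q), (rec r h).2 j]).
exists (Fix wf (fun _ => state) body) => q.
rewrite Fix_eq; last first.
  move=> x f g fg; congr body.
  by apply: functional_extensionality_dep => r; apply: functional_extensionality_dep.
rewrite /body; congr step; congr pair.
  apply/funext => x; apply/seteqP; split => Y /= [?|]; try by left.
    by move=> [r [h ?]]; right; exists r.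
  by move=> [r h ?]; right; exists r, h.
apply/seteqP; split => j /=; first by move=> [r [h ?]]; exists r.
by move=> [r h ?]; exists r, h.
Qed.

(** Each stage consumes countably many rows, so that by [room] a row is left at
    every stage; coherence passes to the unions because stages are linearly
    ordered. *)
Lemma coherent_recursion (st : Q -> state) :
  (forall T s t, coherent A s.1 s.2 -> ~ s.2 t ->
    [/\ countable (step T s).2, coherent A (step T s).1 (s.2 `|` (step T s).2),
        forall x, s.1 x `<=` (step T s).1 x & fulfills T (step T s).1]) ->
  (forall q, st q = step (job q) (gather [set r | lt r q] st)) ->
  (forall q (f : Q -> nat -> J), exists j, forall r n, lt r q -> f r n <> j) ->
  (exists U, coherent A (gather setT st).1 U) /\ forall q, fulfills (job q) (st q).1.
Proof.
move=> stepP stE room; have [wf tr tri] := wo.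
pose pre q := gather [set r | lt r q] st.
have pre_sub r q : lt r q -> forall x, (st r).1 x `<=` (pre q).1 x.
  by move=> rq x Y; right; exists r.
pose good q := coherent A (pre q).1 (pre q).2.
pose done q := [/\ countable (st q).2, coherent A (st q).1 ((pre q).2 `|` (st q).2),
  forall x, (pre q).1 x `<=` (st q).1 x & fulfills (job q) (st q).1].
(* needed for the predecessors of a stage and for all the stages together *)
have gatherP (D : set Q) : (forall q r, D q -> lt r q -> D r) -> (forall q, D q -> done q) ->
    coherent A (gather D st).1 (gather D st).2.
  move=> Dd Ddone.
  pose F o := if o is Some q then (st q).1 else fun=> [set Y : set nat | finite_set (~` Y)].
  pose U o := if o is Some q then (pre q).2 `|` (st q).2 else set0.
  pose E := [set o | if o is Some q then D q else True].
  have -> : gather D st = (fun x => \bigcup_(o in E) F o x, \bigcup_(o in E) U o).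
    congr pair.
      apply/funext => x; apply/seteqP; split => Y /=.
        by move=> [?|[r Dr ?]]; [exists None|exists (Some r)].
      by move=> [[r|] /=]; [right; exists r|left].
    apply/seteqP; split => j /=.
      by move=> [r Dr ?]; exists (Some r) => //; right.
    move=> [[q|] //= Dq [[r rq ?]|?]]; last by exists q.
    by exists r => //; exact: Dd rq.
  apply: (@coherent_bigcup X J K A (option Q) E F U); first by exists None.
    have cofin q : D q -> forall x, F None x `<=` F (Some q) x.
      move=> Dq x Y fY; have [_ _ h _] := Ddone _ Dq; apply: h; by left.
    have up q r : D q -> lt r q -> forall x, F (Some r) x `<=` F (Some q) x.
      move=> Dq rq x Y FY; have [_ _ h _] := Ddone _ Dq; apply: h; by right; exists r.
    move=> [q|] [r|] Eq Er; [|by right; exact: cofin|by left; exact: cofin|by left=> x Y].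
    have [qr|<-|rq] := tri q r; [by left; exact: up|by left=> x Y|by right; exact: up].
  move=> [q|] Eq; last exact: coherent_cofinite.
  by have [] := Ddone _ Eq.
have doneP q : done q.
  elim: (wf q) => {}q _ IH.
  have cr : coherent A (pre q).1 (pre q).2.
    by apply: gatherP => [r s|]; [move=> rq sr; exact: tr rq|exact: IH].
  have [t Ut] : exists t, ~ (pre q).2 t.
    have /choice[f Hf] : forall r, exists e : nat -> J, lt r q ->
        forall t, (st r).2 t -> exists n, e n = t.
      move=> r; have [rq|nrq] := pselect (lt r q).
        have [cr' _ _ _] := IH _ rq.
        have [r0|/set0P r0] := eqVneq (st r).2 set0; first by exists (fun=> j0) => _ t; rewrite r0.
        by have [f fE] := countable_enum cr' r0; exists f => _ t; rewrite fE => -[n _ <-]; exists n.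
      by exists (fun=> j0).
    have [j Hj] := room q f; exists j => -[r rq jr].
    by have [n] := Hf r rq j jr; exact: Hj.
  by rewrite /done stE; exact: stepP cr Ut.
split; last by move=> q; have [] := doneP q.
by exists (gather setT st).2; exact: gatherP.
Qed.
End Recursion.
End Transfinite.

Lemma task_code (X : topologicalType) : countable [set: X] ->
  exists dec : set nat -> task X, forall T, exists j, dec j = T.
Proof.
move=> /countable_injP[i iinj].
pose tl (j : set nat) : set nat := [set n | j n.+2].
pose cd (b0 b1 : Prop) (a : set nat) : set nat :=
  [set n | match n with 0 => b0 | 1 => b1 | n.+2 => a n end]%N.
exists (fun j => if `[< j 0%N >] then inl (tl j)
  else if `[< j 1%N >] then inr (inl (fun n => [set m | tl j (pickle (n, m))]))
  else inr (inr [set x | tl j (i x)])).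
move=> [Y|[W|Z]].
- by exists (cd True False Y); rewrite asboolT.
- exists (cd False True [set k | exists n m, k = pickle (n, m) /\ W n m]).
  rewrite asboolF ?asboolT //.
  congr (inr (inl _)); apply/funext => n; apply/seteqP; split => m /=.
    by move=> [n' [m' [/(pcan_inj (@pickleK _)) [-> ->]]]].
  by move=> Wm; exists n, m.
- exists (cd False False (i @` Z)).
  rewrite !asboolF //.
  congr (inr (inr _)); apply/seteqP; split => x /=; last by exists x.
  by move=> [y Zy /iinj]; rewrite !inE => <-.
Qed.

Lemma unbounded_uniq (K : choiceType) (B : set K) n :
  (forall s, uniq s -> [set` s] `<=` B -> (size s <= n)%N) -> finite_set B.
Proof.
move=> h; apply: contrapT => /(infinite_set_fset n.+1)[C CB].
by rewrite leqNgt ltnS h // fset_uniq.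
Qed.

(** The map [u] embeds [X] in the space of free ultrafilters on [nat]: the traces
    [[set x | u x Y]] are open, and they are exactly the clopen sets of [X]. The last
    clause says that the closure of the image is a weak P-set: a filter [c] for
    which some [Y] belongs to every [u x] but not to [c] is one that lies outside
    this closure, and countably many such [c] are separated from it at once. *)
Definition weak_P_embedding (X : topologicalType) (u : X -> set_system nat) :=
  [/\ forall x, ProperFilter (u x),
      forall x Y, u x Y \/ u x (~` Y),
      forall x Y, finite_set (~` Y) -> u x Y,
      (forall Y, open [set x | u x Y]) /\
        (forall Z, clopen Z -> exists Y, [set x | u x Y] = Z)
    & forall c : nat -> set_system nat,
        (forall n, ProperFilter (c n)) ->
        (forall n Y, finite_set (~` Y) -> c n Y) ->
        (forall n, exists Y, (forall x, u x Y) /\ ~ c n Y) ->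
      exists V, (forall x, u x V) /\ forall n, ~ c n V].

(** Fulfilling all tasks by transfinite recursion gives [u]. For the last clause, a
    filter [c n] that avoids the [n]-th term of a sequence contains at most [n] of
    the sets [V a] attached to it; as the indices [a] are uncountably many, some
    [V a] is avoided by all the [c n]. *)
Lemma weak_P_embedding_exists (X : topologicalType) : countable [set: X] ->
  extremally_disconnected X -> exists u : X -> set_system nat, weak_P_embedding u.
Proof.
move=> cX edX.
have A_il := kunen_matrix_independent_linked.
have [Q [lt [g [wo gs room]]]] := stages_exist uncountable_set_nat.
have [dec decs] := task_code cX.
have s01 : (set0 : set nat) != setT.
  by apply/eqP => /seteqP[_ /(_ 0%N)]; apply.
have [step stepP] := step_exists A_il cX edX s01.
have [st stE] := recursion wo (dec \o g) step.
have [[U [FF Fcof Fo Find]] Fdone] := coherent_recursion A_il set0 wo stepP stE room.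
set u := (gather setT st).1 in FF Fcof Fo Find.
have uP (T : task X) : fulfills (set nat) T u.
  have [j <-] := decs T; have [q <-] := gs j.
  by apply: fulfillsW (Fdone q) => x Y FY; right; exists q.
have prop x : ProperFilter (u x).
  apply: Build_ProperFilter_ex => Y FY.
  by have [m [Ym _]] := Find x Y [::] FY (admissible_nil _ U); exists m.
have nC x Y : u x Y -> u x (~` Y) -> False.
  by move=> uY uC; have [m [? ?]] := filter_ex (filterI uY uC).
exists u; split => //.
- by move=> x Y; apply: (uP (inl Y)).
- split => // Z clZ; have [Y hY] := uP (inr (inr Z)) clZ.
  exists Y; apply/seteqP; split => x /=; last by move/(hY x).1.
  by move=> uY; apply: contrapT => /(hY x).2 /(nC _ _ uY).
move=> c pc cofc cY.
have /choice[Y hY] := cY.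
pose W n : set nat := [set m | (n <= m)%N /\ forall i, (i <= n)%N -> Y i m].
have uW x n : u x (W n).
  apply: filterI.
    apply: Fcof; apply: sub_finite_set (finite_II n) => m /= /negP.
    by rewrite -ltnNge.
  elim: n => [|n IH].
    apply: filterS ((hY 0%N).1 x) => m Ym i.
    by rewrite leqn0 => /eqP ->.
  apply: filterS (filterI IH ((hY n.+1).1 x)) => m [hm Ym] i.
  by rewrite leq_eqVlt => /orP[/eqP ->|/hm].
have Wd m n : (m <= n)%N -> W n `<=` W m.
  move=> mn k [nk hk]; split; first exact: leq_trans nk.
  by move=> i im; apply: hk; exact: leq_trans mn.
have W0 : \bigcap_n W n = set0.
  rewrite -subset0 => m /(_ m.+1 I) [].
  by rewrite ltnn.
have [[x [n]]|[V [uV linkV]]] := uP (inr (inl W)) Wd W0.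
  by move/(nC _ _ (uW x n)).
have fin n : finite_set [set a | c n (V a)].
  apply: (@unbounded_uniq _ _ n) => s us sV; rewrite leqNgt; apply/negP => ns.
  apply: (hY n).2.
  have cV : c n (\bigcap_(a in [set` s]) V a).
    have : {in s, forall a, c n (V a)} by move=> a; exact: sV.
    elim: (s) => [_|a s' IH h].
      by rewrite set_nil bigcap_set0; exact: filterT.
    have cs : c n (\bigcap_(a in [set` s']) V a).
      by apply: IH => b bs; apply: h; rewrite inE bs orbT.
    have ca : c n (V a) by apply: h; exact: mem_head.
    apply: filterS (filterI ca cs) => m [Va Vs] b /=.
    by rewrite inE => /orP[/eqP ->|/Vs].
  have cW : c n (~` ((\bigcap_(a in [set` s]) V a) `\` W (size s))).
    by apply: cofc; rewrite setCK; apply: linkV => //; case: (s) ns.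
  apply: filterS (filterI cV cW) => m [Vm] /not_andP[//|/contrapT [_ h]].
  by apply: h; exact: ltnW.
have [a Na] : exists a, ~ (\bigcup_n [set a | c n (V a)]) a.
  apply: contrapT => /forallNP h; apply: uncountable_set_nat.
  rewrite (_ : [set: _] = \bigcup_n [set a | c n (V a)]); last first.
    by apply/seteqP; split => // a _; apply: contrapT; exact: h.
  by apply: bigcup_countable => // n _; exact: finite_set_countable.
exists (V a); split; first by move=> x; exact: uV.
by move=> n cn; apply: Na; exists n.
Qed.

Local Open Scope ring_scope.

(** * The Cech-Stone compactification of an extremally disconnected space *)

Section CechStoneTheory.
Variables (R : realType) (X : topologicalType).
Notation UF := (unit_function R X).
Notation cube := (prod_topology (fun _ : UF => R)).
Notation e := (cech_stone_map R X).
Implicit Types (z : cube) (Z N : set X) (C : set cube).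

Lemma cube_proj_continuous (f : UF) : continuous (fun z : cube => z f).
Proof. exact: (@proj_continuous UF (fun=> R) f). Qed.

Lemma cech_stone_map_continuous : continuous e.
Proof.
move=> x; apply/cvg_sup => f U [V [[W oW <-] Wx] VU].
have [cf _] := svalP f.
have : nbhs x ((sval f) @^-1` W) by apply: cf; exact: open_nbhs_nbhs.
by apply: filterS => y Wy; exact: VU.
Qed.

Lemma cube_hausdorff : hausdorff_space cube.
Proof. exact: (@hausdorff_product UF (fun=> R) (fun=> @Rhausdorff R)). Qed.

Lemma cech_stone_compact : compact (cech_stone R X).
Proof.
have cI : compact [set z : cube | forall f, `[0, 1]%classic (z f)].
  by apply: (@tychonoff UF (fun=> R) (fun=> `[0, 1]%classic)) => _; exact: segment_compact.
have clI := compact_closed cube_hausdorff cI.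
apply: (subclosed_compact _ cI); first exact: closed_closure.
apply: subset_trans clI; apply: closureS => _ [x _ <-] f /=.
by rewrite in_itv /=; exact: (svalP f).2.
Qed.

(** For clopen [Z] these are the clopen sets of the Cech-Stone compactification,
    and points of the latter are handled through the ultrafilter of clopen sets
    of [X] whose closure contains them. *)
Definition trace_closure Z : set cube := closure (e @` Z).

Lemma trace_closureS Z N : Z `<=` N -> trace_closure Z `<=` trace_closure N.
Proof. by move=> ZN; apply: closureS; exact: image_subset. Qed.

Lemma mem_trace_closure Z x : Z x -> trace_closure Z (e x).
Proof. by move=> Zx; apply: subset_closure; exists x. Qed.

Lemma cech_stone_map_in x : cech_stone R X (e x).
Proof. exact: mem_trace_closure. Qed.

Lemma trace_closure_min Z C : closed C -> (forall x, Z x -> C (e x)) ->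
  trace_closure Z `<=` C.
Proof.
by move=> cC ZC; apply: subset_trans cC; apply: closureS => _ [x /ZC ? <-].
Qed.

Lemma trace_closure_closure Z : trace_closure (closure Z) `<=` trace_closure Z.
Proof.
apply: trace_closure_min; first exact: closed_closure.
move=> x clx B xB; have := clx _ (cech_stone_map_continuous xB).
by move=> [y [Zy By]]; exists (e y); split => //; exists y.
Qed.

Lemma trace_closure0 : trace_closure set0 = set0.
Proof. by rewrite /trace_closure image_set0 closure0. Qed.

Lemma trace_closure_limit_point Z z : ~ range e z -> trace_closure Z z ->
  limit_point (e @` Z) z.
Proof.
move=> ez; rewrite /trace_closure closure_isolated_limit_point => -[|//].
by move=> /isolatedS[x _ xz]; case: ez; exists x.
Qed.

Lemma trace_closureU Z N z : trace_closure (Z `|` N) z ->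
  trace_closure Z z \/ trace_closure N z.
Proof. by rewrite /trace_closure image_setU closureU. Qed.

(** The indicator function of [Z] is one of the coordinates of the cube. *)
Lemma trace_closureC Z z : clopen Z -> trace_closure Z z -> ~ trace_closure (~` Z) z.
Proof.
move=> [oZ cZ]; pose f x : R := if `[< Z x >] then 1 else 0.
have cf : continuous f.
  move=> x; apply: cvg_near_cst; have [Zx|Zx] := pselect (Z x).
    apply: filterS (open_nbhs_nbhs (conj oZ Zx)) => y Zy.
    by rewrite /f !asboolT.
  apply: filterS (open_nbhs_nbhs (conj (closed_openC cZ) Zx)) => y Zy.
  by rewrite /f !asboolF.
have f01 x : 0 <= f x <= 1 by rewrite /f; case: ifP; rewrite lexx ler01.
pose F : UF := exist _ f (conj cf f01).
have clF a : closed [set w : cube | w F = a].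
  apply: (@preimage_closed _ _ (fun w : cube => w F) [set a]); last exact: closed_eq.
  by move=> w _; exact: cube_proj_continuous.
move=> /(trace_closure_min (clF 1)) z1 /(trace_closure_min (clF 0)) z0.
have : (1 : R) = 0.
  rewrite -z1 ?z0 // => x Zx; rewrite /= /cech_stone_map /join_product /= /f.
    by rewrite asboolF.
  by rewrite asboolT.
by move/eqP; rewrite oner_eq0.
Qed.

Lemma trace_closure_map x Z : clopen Z -> trace_closure Z (e x) -> Z x.
Proof.
move=> clZ Zx; apply: contrapT => nZ; apply: (trace_closureC clZ Zx).
exact: mem_trace_closure.
Qed.

Lemma trace_closureI Z N z : clopen N -> trace_closure Z z -> trace_closure N z ->
  trace_closure (Z `&` N) z.
Proof.
move=> clN Zz Nz; have : trace_closure ((Z `&` N) `|` (Z `\` N)) z.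
  by rewrite setUIDK.
move=> /trace_closureU[//|/(@trace_closureS _ (~` N))].
by case/(_ (@subIsetr _ _ _))/(trace_closureC clN Nz).
Qed.

Lemma trace_closure_cover z Z : cech_stone R X z -> trace_closure Z z \/ trace_closure (~` Z) z.
Proof. by move=> bz; apply: trace_closureU; rewrite setUv. Qed.

Lemma trace_closure_compact (F : set_system X) : ProperFilter F ->
  exists z, cech_stone R X z /\ forall Z, F Z -> trace_closure Z z.
Proof.
move=> FF; have [|z [bz cz]] := cech_stone_compact (fmap_proper_filter e FF).
  by apply: (@filterS _ F _ setT); [move=> x _; exact: cech_stone_map_in|exact: filterT].
exists z; split => // Z FZ B zB; apply: (cz (e @` Z)) => //.
by apply: (@filterS _ F _ Z) => // x Zx; exists x.
Qed.

Section ExtremallyDisconnected.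
Hypothesis edX : extremally_disconnected X.

(** The cube is regular, and the closure in [X] of the trace of an open set is
    clopen. *)
Lemma trace_closure_nbhs z C : cech_stone R X z -> nbhs z C -> exists Z,
  [/\ clopen Z, trace_closure Z z & trace_closure Z `<=` C].
Proof.
move=> bz /(@uniform_regular cube)[D zD DC].
have oG : open (e @^-1` D°).
  by apply: open_comp; [move=> x _; exact: cech_stone_map_continuous|exact: open_interior].
exists (closure (e @^-1` D°)); split.
- by split; [exact: edX|exact: closed_closure].
- have zG : trace_closure (e @^-1` D°) z.
    move=> B zB; have [w [[x _ <-] [Bx Dx]]] := bz _ (filterI zB (nbhs_interior zD)).
    by exists (e x); split => //; exists x.
  exact: trace_closureS (@subset_closure _ _) _ zG.
- apply: subset_trans (@trace_closure_closure _) _; apply: subset_trans DC.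
  by apply: closureS => _ [x /interior_subset Dx <-].
Qed.

Lemma trace_separated z w : cech_stone R X z -> z <> w ->
  exists Z, [/\ clopen Z, trace_closure Z z & ~ trace_closure Z w].
Proof.
move=> bz zw; have [C [zC NC]] : exists C, nbhs z C /\ ~ C w.
  move: cube_hausdorff; rewrite open_hausdorff => /(_ z w).
  case; first exact/eqP.
  move=> [A B] /= [/set_mem zA /set_mem wB] [oA oB /eqP AB].
  exists A; split; first exact: open_nbhs_nbhs.
  by move=> wA; have : (A `&` B) w by []; rewrite AB.
have [Z [clZ Zz ZC]] := trace_closure_nbhs bz zC.
by exists Z; split => // /ZC.
Qed.

Lemma limit_point_trace C z : C `<=` cech_stone R X -> cech_stone R X z ->
  limit_point C z <->
  forall Z, clopen Z -> trace_closure Z z -> exists w, [/\ C w, w <> z & trace_closure Z w].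
Proof.
move=> Cb bz; split.
  move=> lz Z clZ Zz.
  have zN : nbhs z (~` trace_closure (~` Z)).
    apply: open_nbhs_nbhs; split; first by apply: closed_openC; exact: closed_closure.
    exact: trace_closureC.
  have [w [/eqP wz Cw nw]] := lz _ zN; exists w; split => //.
  by have [] := trace_closure_cover Z (Cb _ Cw).
move=> H U zU; have [Z [clZ Zz ZU]] := trace_closure_nbhs bz zU.
by have [w [Cw /eqP wz /ZU Uw]] := H _ clZ Zz; exists w.
Qed.

Lemma clopen_base x (U : set X) : completely_regular_space X -> nbhs x U ->
  exists Z, [/\ clopen Z, Z x & Z `<=` U].
Proof.
move=> /(@completely_regular_regular R) rX /rX[V xV VU].
exists (closure V°); split.
- by split; [apply: edX; exact: open_interior|exact: closed_closure].
- by apply: subset_closure; exact: nbhs_singleton (nbhs_interior xV).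
- by apply: subset_trans VU; apply: closureS; exact: interior_subset.
Qed.

End ExtremallyDisconnected.
End CechStoneTheory.

Arguments trace_closure R {X} Z _.

Section Nat.
Variable R : realType.
Notation e := (cech_stone_map R nat).
Implicit Types (Y : set nat) (z : prod_topology (fun _ : unit_function R nat => R)).

Lemma clopen_nat Y : clopen Y.
Proof. by split; [exact: discrete_open|exact: discrete_closed]. Qed.

Lemma extremally_disconnected_nat : extremally_disconnected nat.
Proof. by move=> U _; exact: discrete_open. Qed.

Lemma trace_ultrafilter z : cech_stone R nat z ->
  ProperFilter [set Y | trace_closure R Y z].
Proof.
move=> bz; apply: Build_ProperFilter_ex.
  move=> Y zY; apply/set0P/negP => /eqP Y0; move: zY.
  by rewrite /= Y0 trace_closure0.
split => //=.
- by move=> Y Y' zY zY'; apply: trace_closureI => //; exact: clopen_nat.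
- by move=> Y Y' YY'; exact: trace_closureS.
Qed.

Lemma remainder_cofinite z Y : cech_stone_remainder R nat z ->
  finite_set (~` Y) -> trace_closure R Y z.
Proof.
move=> [bz ez] fY; have [//|zY] := trace_closure_cover Y bz.
case: ez; suff [n _ nz] : (e @` ~` Y) z by exists n.
move: zY; rewrite /trace_closure -(closure_id _).1 //.
apply: (accessible_finite_set_closed.1 _ _ (finite_image _ fY)).
exact: hausdorff_accessible (@cube_hausdorff _ _).
Qed.

(** The point exists by compactness; as every subset of [nat] is clopen, it determines
    the ultrafilter. *)
Lemma free_ultrafilter_point (F : set_system nat) : ProperFilter F ->
  (forall Y, F Y \/ F (~` Y)) -> (forall Y, finite_set (~` Y) -> F Y) ->
  exists z, cech_stone_remainder R nat z /\ forall Y, trace_closure R Y z <-> F Y.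
Proof.
move=> FF Fu Fc; have [z [bz Fz]] := @trace_closure_compact R nat F FF.
have zF Y : trace_closure R Y z -> F Y.
  have [//|/Fz zY] := Fu Y => /(trace_closureC (clopen_nat Y)).
  by case/(_ zY).
exists z; split; last by move=> Y; split => [/zF|/Fz].
split => // -[n _ nz].
have /Fz : F (~` [set n]) by apply: Fc; rewrite setCK; exact: finite_set1.
rewrite -nz => /(trace_closure_map (clopen_nat _)); exact.
Qed.

End Nat.

(** * From a remote point to a lonely point *)

Lemma limit_pointS (T : topologicalType) (A B : set T) : A `<=` B ->
  limit_point A `<=` limit_point B.
Proof. by move=> AB p lA U /lA[y [? /AB ? ?]]; exists y. Qed.

Section OHI.
Variable X : topologicalType.

Lemma crowded_open (U : set X) x : crowded [set: X] -> open U -> U x ->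
  exists2 y, U y & y <> x.
Proof.
move=> cX oU Ux; apply: contrapT => N.
suff : isolated [set: X] x by rewrite cX.
split; first by rewrite inE.
exists U; first exact: open_nbhs_nbhs.
rewrite setIT; apply/seteqP; split => y; last by move=> ->.
by move=> Uy; apply: contrapT => yx; apply: N; exists y.
Qed.

Lemma discrete_nowhere_dense (M : set X) : hausdorff_space X -> crowded [set: X] ->
  (forall x, M x -> exists G, [/\ open G, G x & G `&` M `<=` [set x]]) ->
  nowhere_dense M.
Proof.
move=> hX cX Md; rewrite /nowhere_dense -subset0 => z Vz.
have oV : open (closure M)° by exact: open_interior.
have [x [Mx Vx]] := interior_subset Vz _ (open_nbhs_nbhs (conj oV Vz)).
have [G [oG Gx GM]] := Md x Mx.
have [y [Gy Vy] yx] := crowded_open cX (openI oG oV) (conj Gx Vx).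
move: hX; rewrite open_hausdorff => /(_ y x) [|[A B] /=]; first exact/eqP.
move=> [/set_mem Ay /set_mem Bx] [oA oB /eqP AB].
have [w [Mw [Gw Aw]]] := interior_subset Vy _
  (filterI (open_nbhs_nbhs (conj oG Gy)) (open_nbhs_nbhs (conj oA Ay))).
have wx : w = x by exact: GM.
have : (A `&` B) x by split => //; rewrite -wx.
by rewrite AB.
Qed.

(** Otherwise [M] and its complement would both be dense in a nonempty open set. *)
Lemma ohi_nowhere_dense (M : set X) : open_hereditarily_irresolvable X ->
  M° = set0 -> nowhere_dense M.
Proof.
move=> [_ ohi] M0; apply: contrapT => /eqP/set0P V0.
have oV : open (closure M)° by exact: open_interior.
have [_] := ohi _ oV V0; apply.
exists ((closure M)° `&` M), ((closure M)° `\` M); split; last first.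
- by apply/seteqP; split => // x [[_ Mx] [_]].
- split; first exact: subDsetl.
  move=> x Vx B xB; apply: contrapT => /nonemptyPn N.
  suff : M° x by rewrite M0.
  have : nbhs x (B `&` (closure M)°) by apply: filterI => //; exact: open_nbhs_nbhs.
  apply: filterS => y [By Vy]; apply: contrapT => My.
  suff : (((closure M)° `\` M) `&` B) y by rewrite N.
  by [].
- split; first exact: subIsetl.
  move=> x Vx B xB.
  have [y [My [By Vy]]] := interior_subset Vx _ (filterI xB (open_nbhs_nbhs (conj oV Vx))).
  by exists y.
Qed.

End OHI.

Section LonelyFromRemote.
Variables (R : realType) (X : topologicalType).
Hypotheses (tX : tychonoff_space X) (cX : countable [set: X])
  (edX : extremally_disconnected X) (ohiX : open_hereditarily_irresolvable X).
Variable p : prod_topology (fun _ : unit_function R X => R).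
Hypotheses (remp : remote_point p) (wpp : weak_P_point (cech_stone_remainder R X) p).
Notation e := (cech_stone_map R X).
Implicit Types M N : set X.

Let bp : cech_stone R X p. Proof. by case: remp => -[]. Qed.
Let ep : ~ range e p. Proof. by case: remp => -[]. Qed.

Lemma remote_nowhere_dense N : nowhere_dense N -> ~ trace_closure R N p.
Proof.
move=> nN Np; have [_ /(_ N nN)] := remp; apply.
exact: trace_closure_limit_point.
Qed.

Lemma remote_interior M : trace_closure R M p -> trace_closure R M° p.
Proof.
move=> Mp; have : trace_closure R (M° `|` (M `\` M°)) p.
  by rewrite setDUK //; exact: interior_subset.
move=> /trace_closureU[//|]; case/remote_nowhere_dense.
apply: ohi_nowhere_dense => //; rewrite -subset0 => x Ix.
have [Mx] := interior_subset Ix; apply.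
by move: Ix; apply: filterS => y [].
Qed.

(** The filter of traces of neighbourhoods of a remote point is an ultrafilter on
    the underlying set of [X]: by OHI a set differs from its interior by a nowhere
    dense set, and disjoint open sets have disjoint clopen closures. *)
Lemma remote_trace_setI M N : trace_closure R M p -> trace_closure R N p ->
  trace_closure R (M `&` N) p.
Proof.
move=> /remote_interior Mp /remote_interior Np.
have clN : clopen (closure N°).
  by split; [apply: edX; exact: open_interior|exact: closed_closure].
have : trace_closure R (M° `&` closure N°) p.
  apply: trace_closureI => //; apply: trace_closureS Np; exact: subset_closure.
move=> H; apply: trace_closure_closure; apply: trace_closureS H => x [Mx Nx] B xB.
have oM : open M° by exact: open_interior.
have [y [Ny [By My]]] := Nx _ (filterI xB (open_nbhs_nbhs (conj oM Mx))).
by exists y; split => //; split; exact: interior_subset.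
Qed.

Variable u : X -> set_system nat.
Hypothesis uE : weak_P_embedding u.

Notation cube := (prod_topology (fun _ : unit_function R nat => R)).
Notation h Y := [set x | u x Y].
Notation rem := (cech_stone_remainder R nat).

Let uP x : ProperFilter (u x). Proof. by have [] := uE. Qed.

#[local] Existing Instance uP.

Let us Z : clopen Z -> exists Y, h Y = Z.
Proof. by have [_ _ _ [_ us] _] := uE; exact: us. Qed.

Let uo Y : open (h Y). Proof. by have [_ _ _ [uo _] _] := uE. Qed.

Let hC Y : h (~` Y) = ~` h Y.
Proof.
apply/seteqP; split => x /=; last by move=> uY; have [_ uU _ _ _] := uE; have [] := uU x Y.
by move=> uc uY; have [m []] := filter_ex (filterI uY uc).
Qed.

Let h_clopen Y : clopen (h Y).
Proof. by split; [exact: uo|rewrite -openC -hC; exact: uo]. Qed.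

(** [E x] and [q] are the points of the remainder of [nat] that correspond to the
    ultrafilter [u x] and to the limit of the [u x] along the trace of [p]. *)
Variables (E : X -> cube) (q : cube).
Hypotheses (remE : forall x, rem (E x)) (remq : rem q)
  (EP : forall x Y, trace_closure R Y (E x) <-> u x Y)
  (qP : forall Y, trace_closure R Y q <-> trace_closure R (h Y) p).

Let bE x : cech_stone R nat (E x). Proof. by have [] := remE x. Qed.
Let bq : cech_stone R nat q. Proof. by have [] := remq. Qed.

Lemma E_inj x y : E x = E y -> x = y.
Proof.
move=> Exy; apply: contrapT => /eqP xy.
have [hX crX] := tX.
move: hX; rewrite open_hausdorff => /(_ x y xy) [[A B] /= [/set_mem Ax /set_mem By]].
move=> [oA oB /eqP AB].
have [Z [clZ Zx ZA]] := clopen_base R edX crX (open_nbhs_nbhs (conj oA Ax)).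
have [Y hY] := us clZ.
have : h Y y by rewrite /= -EP -Exy EP -[u x Y]/(h Y x) hY.
rewrite hY => /ZA Ay; have : (A `&` B) y by [].
by rewrite AB.
Qed.

Lemma E_neq_q x : E x <> q.
Proof.
move=> Exq; have [|Z [clZ Zp]] := trace_separated edX bp (w := e x).
  by move=> pe; apply: ep; exists x.
have [Y hY] := us clZ; apply; apply: mem_trace_closure; rewrite -hY /=.
by rewrite -EP Exq qP hY.
Qed.

Lemma limit_point_image M : trace_closure R M p -> limit_point (E @` M) q.
Proof.
move=> Mp; apply/(limit_point_trace (@extremally_disconnected_nat)) => //.
  by move=> _ [x _ <-]; exact: bE.
move=> Y _ Yq.
have : trace_closure R (M `&` h Y) p by apply: trace_closureI => //; exact/qP.
have [->|/set0P[x [Mx Yx]] _] := eqVneq (M `&` h Y) set0; first by rewrite trace_closure0.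
by exists (E x); split; [exists x|exact: E_neq_q|exact/EP].
Qed.

(** Only the part of [C] in the range of [E] accumulates at [q]. The points of [C]
    outside the closure of the range are kept away because this closure is a weak
    P-set. The points [c] in the closure but off the range correspond to points
    [phi c] of the remainder of [X], and are kept away because [p] is a weak P-point
    there. *)
Lemma limit_point_preimage (C : set cube) : C `<=` rem -> countable C ->
  limit_point C q -> trace_closure R (E @^-1` C) p.
Proof.
move=> Cr cC lC; apply: contrapT => NM.
have bC c : C c -> cech_stone R nat c by move=> /Cr[].
have [Z [clZ Zp ZM]] : exists Z, [/\ clopen Z, trace_closure R Z p &
    trace_closure R Z `<=` ~` trace_closure R (E @^-1` C)].
  apply: trace_closure_nbhs => //; apply: open_nbhs_nbhs; split => //.
  by apply: closed_openC; exact: closed_closure.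
have [Y0 hY0] := us clZ.
(* K is the closure of the range of E *)
pose K c := forall Y, (forall x, u x Y) -> trace_closure R Y c.
have [V [uV CV]] : exists V, (forall x, u x V) /\
    forall c, C c -> trace_closure R V c -> K c.
  pose C1 := [set c | C c /\ ~ K c].
  have [C10|/set0P C1n] := eqVneq C1 set0.
    exists setT; split => [x|c Cc _]; first exact: filterT.
    by apply: contrapT => Kc; have : C1 c by []; rewrite C10.
  have [|f fC] := countable_enum _ C1n.
    by apply: sub_countable cC; apply: subset_card_le => c [].
  have fC1 n : C1 (f n) by rewrite fC; exists n.
  have [_ _ _ _ uK] := uE.
  have [n|n Y|n|V [uV fV]] := uK (fun n => [set Y | trace_closure R Y (f n)]).
  - by apply: trace_ultrafilter; apply: bC; exact: (fC1 n).1.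
  - by apply: remainder_cofinite; apply: Cr; exact: (fC1 n).1.
  - have [_ /existsNP[Y /not_implyP[? ?]]] := fC1 n; by exists Y.
  exists V; split => // c Cc cV; apply: contrapT => Kc.
  by have : C1 c by []; rewrite fC => -[n _ fn]; apply: (fV n); rewrite /= fn.
have [Y2 [Y2q CY2]] : exists Y2, trace_closure R Y2 q /\
    forall c, C c -> K c -> c <> q -> trace_closure R Y2 c -> range E c.
  pose C2 := [set c | [/\ C c, K c, c <> q & ~ range E c]].
  have /choice[phi phiP] : forall c, exists z, C2 c -> cech_stone R X z /\
      forall Y, trace_closure R Y c -> trace_closure R (h Y) z.
    move=> c; have [[Cc Kc _ _]|nc] := pselect (C2 c); last by exists p.
    have Fc := trace_ultrafilter (bC _ Cc).
    have ne Y : trace_closure R Y c -> h Y !=set0.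
      move=> Yc; apply/set0P/negP => /eqP hY.
      apply: (trace_closureC (clopen_nat Y) Yc); apply: Kc => x.
      by rewrite -[u x _]/(h (~` Y) x) hC hY.
    have [|z [bz zc]] := @trace_closure_compact R X
        (filter_from [set Y | trace_closure R Y c] (fun Y => h Y)).
      apply: filter_from_proper => //; apply: filter_from_filter.
        by exists setT; exact: (filterT : [set Y | trace_closure R Y c] setT).
      move=> Y Y' Yc Yc'; exists (Y `&` Y').
        exact: (filterI (F := [set Y | trace_closure R Y c])).
      by move=> x /= ux; split; apply: filterS ux => m [].
    exists z => _; split => // Y Yc; apply: zc; by exists Y.
  have phirem c : C2 c -> cech_stone_remainder R X (phi c).
    move=> C2c; have [bphi phih] := phiP c C2c; split => // -[x _ ex].
    have [Cc _ _ nE] := C2c; apply: nE; exists x => //; apply: contrapT => Ec.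
    have [|Y [clY Yc]] := trace_separated (@extremally_disconnected_nat) (bC _ Cc) (w := E x).
      by move=> ce; apply: Ec.
    apply; apply/EP; have := phih _ Yc; rewrite -ex.
    exact: trace_closure_map.
  have phip c : C2 c -> phi c <> p.
    move=> C2c; have [bphi phih] := phiP c C2c => pc.
    have [Cc _ cq _] := C2c.
    have [Y [clY Yc]] := trace_separated (@extremally_disconnected_nat) (bC _ Cc) cq.
    by apply; apply/qP; rewrite -pc; exact: phih.
  have [_ wp] := wpp.
  have /wp nl : phi @` C2 `<=` cech_stone_remainder R X.
    by move=> _ [c C2c <-]; exact: phirem.
  have cphi : countable (phi @` C2).
    apply: sub_countable (card_image_le _ _) _.
    by apply: sub_countable cC; apply: subset_card_le => c [].
  have := nl cphi; rewrite (limit_point_trace edX) //; last first.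
    by move=> _ [c /phiP[? _] <-].
  move=> /existsNP[Z2 /not_implyP[clZ2 /not_implyP[Z2p NZ2]]].
  have [Y2 hY2] := us clZ2; exists Y2; split; first by apply/qP; rewrite hY2.
  move=> c Cc Kc cq Y2c; apply: contrapT => nE; apply: NZ2.
  have C2c : C2 c by [].
  exists (phi c); split; [by exists c|exact: phip|rewrite -hY2].
  exact: (phiP c C2c).2.
have Yq : trace_closure R (Y0 `&` V `&` Y2) q.
  apply: trace_closureI => //; first exact: clopen_nat.
  apply: trace_closureI; first exact: clopen_nat.
    by apply/qP; rewrite hY0.
  apply/qP; have -> : h V = setT by apply/seteqP; split => // x _; exact: uV.
  exact: bp.
have [c [Cc cq Yc]] :=
  (limit_point_trace (@extremally_disconnected_nat) bC bq).1 lC _ (clopen_nat _) Yq.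
have cV : trace_closure R V c by apply: trace_closureS Yc => m [[]].
have cY2 : trace_closure R Y2 c by apply: trace_closureS Yc => m [[]].
have [x _ xc] := CY2 c Cc (CV c Cc cV) cq cY2.
have Zx : Z x.
  rewrite -hY0 /=; apply/EP; rewrite xc; by apply: trace_closureS Yc => m [[]].
apply: (ZM (e x)); apply: mem_trace_closure => //=.
by rewrite xc.
Qed.

(** By [limit_point_preimage] and [limit_point_image], accumulation of countable sets
    at [q] is membership in the ultrafilter that [p] traces on [X]. *)
Lemma lonely_image : lonely rem q.
Proof.
have [hX crX] := tX; have [crwX _] := ohiX.
have Emem x C : isolated C (E x) -> exists Y, [/\ open (h Y), h Y x &
    h Y `&` (E @^-1` C) `<=` [set x]].
  move=> [_ [W xW WC]].
  have [Y [_ YE YW]] := trace_closure_nbhs (@extremally_disconnected_nat) (@bE x) xW.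
  exists Y; split; [exact: uo|exact/EP|move=> y [Yy Cy]].
  by apply: E_inj; rewrite -[_ = _]/([set E x] (E y)) -WC; split => //; apply/YW/EP.
split => //.
- move=> C Cr cC dC lC.
  apply: (remote_nowhere_dense _ (limit_point_preimage Cr cC lC)).
  apply: discrete_nowhere_dense => // x Cx.
  have [Y [? ? ?]] := Emem x C (eq_ind_r (fun D : set cube => D (E x)) Cx dC).
  by exists (h Y).
- exists (range E); split.
  + by move=> _ [x _ <-].
  + by apply: sub_countable (card_image_le _ _) _; exact: cX.
  + rewrite /crowded -subset0 => z iz; have [x _ xz] := isolatedS iz.
    rewrite -xz in iz; have [Y [oY Yx sY]] := Emem _ _ iz.
    have [y Yy yx] := crowded_open crwX oY Yx; apply: yx; apply: sY.
    by split => //; exists y.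
  + by apply: limit_point_image; exact: bp.
- move=> C D Cr Dr cC cD lC lD.
  have := remote_trace_setI (limit_point_preimage Cr cC lC) (limit_point_preimage Dr cD lD).
  move=> /limit_point_image; apply: limit_pointS => _ [x [Cx Dx] <-] //.
Qed.

End LonelyFromRemote.

Lemma lonely_of_remote (R : realType) (X : topologicalType)
    (p : prod_topology (fun _ : unit_function R X => R)) :
  tychonoff_space X -> countable [set: X] -> extremally_disconnected X ->
  open_hereditarily_irresolvable X -> remote_point p ->
  weak_P_point (cech_stone_remainder R X) p ->
  exists q, lonely (cech_stone_remainder R nat) q.
Proof.
move=> tX cX edX ohiX remp wpp.
have [u uE] := weak_P_embedding_exists cX edX.
have [uP uU uC [uo us] uK] := uE.
have bp : cech_stone R X p by case: remp => -[].
have /choice[E EP] := fun x => free_ultrafilter_point R (uP x) (uU x) (uC x).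
have hC Y : [set x | u x (~` Y)] = ~` [set x | u x Y].
  apply/seteqP; split => x /=; last by move=> uY; have [] := uU x Y.
  by move=> uc uY; have [m []] := filter_ex (filterI uY uc).
have clh Y : clopen [set x | u x Y].
  by split; [exact: uo|rewrite -openC -hC; exact: uo].
have [|||q [remq qP]] := @free_ultrafilter_point R [set Y | trace_closure R [set x | u x Y] p].
- apply: Build_ProperFilter_ex.
    move=> Y /= Yp; have [Y0|/set0P[x /= uY]] := eqVneq [set x | u x Y] set0.
      by move: Yp; rewrite Y0 trace_closure0.
    exact: filter_ex uY.
  split => /=.
  + by rewrite (_ : [set x | _] = setT) //; apply/seteqP; split => // x _; exact: filterT.
  + move=> Y Y' Yp Y'p; have := trace_closureI (clh Y') Yp Y'p.
    by apply: trace_closureS => x [? ?]; exact: filterI.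
  + move=> Y Y' YY'; apply: trace_closureS => x /=; exact: filterS.
- by move=> Y; rewrite /= hC; exact: trace_closure_cover.
- move=> Y fY; rewrite /= (_ : [set x | _] = setT) //.
  by apply/seteqP; split => // x _; exact: uC.
exists q; apply: (@lonely_image R X tX cX edX ohiX p remp wpp u uE) => //.
- by move=> x; exact: (EP x).1.
- by move=> x; exact: (EP x).2.
Qed.

(** * Countable subspaces of the compactification of [nat] *)

Lemma crowdedI (T : topologicalType) (A G : set T) : open G -> crowded A ->
  crowded (A `&` G).
Proof.
move=> oG cA; rewrite /crowded -subset0 => x ix; have [Ax Gx] := isolatedS ix.
have [_ [V xV VA]] := ix; suff : isolated A x by rewrite cA.
split; first exact/mem_set.
exists (V `&` G); first by apply: filterI => //; exact: open_nbhs_nbhs.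
by rewrite -setIA (setIC G).
Qed.

Section Subtype.
Variables (T : topologicalType) (Y : set T).
Notation val := (@set_val T Y).

Lemma set_val_cont : continuous (val : Y -> T).
Proof. exact: initial_continuous. Qed.

Lemma set_val_in (x : Y) : Y (val x). Proof. exact: set_valP. Qed.

Lemma set_val_surj z : Y z -> exists x : Y, val x = z.
Proof. by move=> Yz; exists (SigSub (mem_set Yz)). Qed.

Lemma subtype_nbhs (x : Y) (B : set Y) : nbhs x B ->
  exists G, [/\ open G, G (val x) & val @^-1` G `<=` B].
Proof. by move=> [_ [[G oG <-] Gx GB]]; exists G. Qed.

Lemma subtype_closure (U : set Y) (x : Y) : closure U x <-> closure (val @` U) (val x).
Proof.
split=> clx B xB.
  by have [y [Uy By]] := clx _ (set_val_cont xB); exists (val y); split => //; exists y.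
have [G [oG Gx GB]] := subtype_nbhs xB.
have [_ [[y Uy <-] Gy]] := clx _ (open_nbhs_nbhs (conj oG Gx)).
by exists y; split => //; exact: GB.
Qed.

Lemma subtype_crowded : crowded Y -> crowded [set: Y].
Proof.
move=> cY; rewrite /crowded -subset0 => x [_ [V xV VT]].
have [G [oG Gx GV]] := subtype_nbhs xV.
suff : isolated Y (val x) by rewrite cY.
split; first exact/mem_set/set_val_in.
exists G; first exact: open_nbhs_nbhs.
apply/seteqP; split => z; last by move=> ->; split => //; exact: set_val_in.
move=> [Gz Yz]; have [y yz] := set_val_surj Yz.
have : (V `&` setT) y by split => //; apply: GV; rewrite /= yz.
by rewrite VT -yz => ->.
Qed.

End Subtype.

Section Hewitt.
Variables (T : topologicalType) (A : set T).

(** Hewitt's decomposition: a maximal pair of disjoint subsets that are dense in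
    each other; beyond its closure every nonempty open set is irresolvable. *)
Lemma maximal_resolvable : exists D1 D2 : set T,
  [/\ D1 `<=` closure D2, D2 `<=` closure D1, D1 `&` D2 = set0,
      D1 `|` D2 `<=` A
    & forall B1 B2, B1 `<=` closure B2 -> B2 `<=` closure B1 ->
        B1 `&` B2 = set0 -> B1 `|` B2 `<=` A `\` (D1 `|` D2) -> B1 `|` B2 = set0].
Proof.
(* a pair of sets is a set of pairs, so that pairs are ordered by inclusion *)
pose s (D : set (bool * T)) b := [set z | D (b, z)].
pose P (D : set (bool * T)) := [/\ s D true `<=` closure (s D false),
  s D false `<=` closure (s D true), s D true `&` s D false = set0 &
  s D true `|` s D false `<=` A].
have [|D [[D12 D21 D0 DA] Dmax]] := @Zorn_bigcup (bool * T)%type P.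
  move=> F FP tot; split.
  - move=> z [D FD Dz]; have [h _ _ _] := FP _ FD.
    by apply: closureS (h z Dz) => w Dw; exists D.
  - move=> z [D FD Dz]; have [_ h _ _] := FP _ FD.
    by apply: closureS (h z Dz) => w Dw; exists D.
  - rewrite -subset0 => z [[D FD Dz] [D' FD' Dz']].
    have [h|h] := tot _ _ FD FD'.
      have [_ _ + _] := FP _ FD'; rewrite -subset0; apply; split; last exact: Dz'.
      exact: h.
    have [_ _ + _] := FP _ FD; rewrite -subset0; apply; split; first exact: Dz.
    exact: h.
  - by move=> z [] [D FD Dz]; have [_ _ _] := FP _ FD; apply; [left|right].
exists (s D true), (s D false); split => // B1 B2 B12 B21 B0 BA.
apply: contrapT => /eqP/set0P[z Bz].
pose D' : set (bool * T) := [set w | D w \/ if w.1 then B1 w.2 else B2 w.2].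
have sD' b : s D' b = s D b `|` (if b then B1 else B2).
  by apply/seteqP; split => w; case: b.
apply: (Dmax D').
  split; first by move=> w Dw; left.
  move=> D'D; have [_ nD] := BA _ Bz; apply: nD.
  by case: Bz => Bz; [left|right]; apply: D'D; right.
split; rewrite !sD'.
- by rewrite closureU; apply: setUSS.
- by rewrite closureU; apply: setUSS.
- rewrite setIUl !setIUr D0 B0 set0U setU0; apply/seteqP; split => // w [[a b]|[a b]].
    by have [_ []] := BA w (or_intror b); left.
  by have [_ []] := BA w (or_introl a); right.
- move=> w [[h|h]|[h|h]]; [by apply: DA; left|by have [] := BA w (or_introl h)
    |by apply: DA; right|by have [] := BA w (or_intror h)].
Qed.

End Hewitt.

Section Separation.
Variable R : realType.
Notation cube := (prod_topology (fun _ : unit_function R nat => R)).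
Implicit Types C D : set cube.

(** Separated countable subsets of the compactification of [nat] have disjoint
    closures; this makes its countable subspaces extremally disconnected. *)
Lemma separate_countable C D : C `<=` cech_stone R nat -> D `<=` cech_stone R nat ->
  countable C -> countable D -> C `&` closure D = set0 -> closure C `&` D = set0 ->
  exists Y, C `<=` trace_closure R Y /\ D `<=` trace_closure R (~` Y).
Proof.
have nb (C' D' : set cube) c : C' `<=` cech_stone R nat -> D' `<=` cech_stone R nat ->
    C' `&` closure D' = set0 -> C' c ->
    exists Y, trace_closure R Y c /\ D' `<=` trace_closure R (~` Y).
  move=> bC bD CD Cc.
  have [|Y [_ Yc YD]] := trace_closure_nbhs (@extremally_disconnected_nat) (bC _ Cc)
      (C := ~` closure D').
    apply: open_nbhs_nbhs; split; first by apply: closed_openC; exact: closed_closure.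
    by move=> Dc; have : (C' `&` closure D') c by []; rewrite CD.
  exists Y; split => // d Dd; have [|//] := trace_closure_cover Y (bD _ Dd).
  by move=> /YD; case; exact: subset_closure.
move=> bC bD cC cD CD DC.
have [C0|/set0P nC] := eqVneq C set0.
  by exists set0; rewrite setC0; split; [rewrite C0|exact: bD].
have [D0|/set0P nD] := eqVneq D set0.
  by exists setT; rewrite setCT; split; [exact: bC|rewrite D0].
have [c cE] := countable_enum cC nC; have [d dE] := countable_enum cD nD.
have Cc n : C (c n) by rewrite cE; exists n.
have Dd n : D (d n) by rewrite dE; exists n.
have /choice[Y HY] := fun n => nb _ _ _ bC bD CD (Cc n).
have /choice[Z HZ] := fun n => nb _ _ _ bD bC (etrans (setIC _ _) DC) (Dd n).
(* the n-th neighbourhood is trimmed by the first n neighbourhoods of the other side *)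
have trim (w : cube) (W : set nat) (S : nat -> set nat) n :
    cech_stone R nat w -> trace_closure R W w ->
    (forall i, trace_closure R (~` S i) w) ->
    trace_closure R (W `\` \bigcup_(i in [set i | (i <= n)%N]) S i) w.
  move=> bw Ww Sw; elim: n => [|n IH].
    rewrite (_ : _ `\` _ = W `&` ~` S 0%N).
      by apply: trace_closureI => //; exact: clopen_nat.
    apply/seteqP; split => m [Wm h]; split => //.
      by move=> S0; apply: h; exists 0%N.
    by move=> [i /=]; rewrite leqn0 => /eqP ->.
  have := trace_closureI (clopen_nat (~` S n.+1)) IH (Sw n.+1).
  apply: trace_closureS => m [[Wm h] Sm]; split => // -[i /=].
  rewrite leq_eqVlt => /orP[/eqP -> //|il Si]; apply: h; by exists i.
exists (\bigcup_n (Y n `\` \bigcup_(i in [set i | (i <= n)%N]) Z i)); split.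
  rewrite cE => _ [n _ <-]; apply: trace_closureS (@bigcup_sup _ _ n setT _ I) _ _.
  apply: trim; [exact: bC|exact: (HY n).1|].
  by move=> i; apply: (HZ i).2.
rewrite dE => _ [n _ <-].
apply: (@trace_closureS _ _ (Z n `\` \bigcup_(i in [set i | (i <= n)%N]) Y i)).
  move=> m [Zm Ym] [k _ [Yk Zk]]; have [nk|kn] := leqP n k.
    by apply: Zk; exists n.
  by apply: Ym; exists k => //=; exact: ltnW.
apply: trim; [exact: bD|exact: (HZ n).1|].
by move=> i; apply: (HY i).2.
Qed.

End Separation.

Lemma closure_limit_point_notin (T : topologicalType) (A : set T) z :
  closure A z -> ~ A z -> limit_point A z.
Proof. by rewrite closure_isolated_limit_point => -[/isolatedS|]. Qed.

Section SubspaceOfOmegaStar.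
Variable R : realType.
Notation cube := (prod_topology (fun _ : unit_function R nat => R)).
Variable Y : set cube.
Hypotheses (bY : Y `<=` cech_stone R nat) (cY : countable Y).
Notation val := (@set_val cube Y).
Implicit Types M U : set Y.

Lemma subspace_countable : countable [set: Y].
Proof.
move/countable_injP: cY => [f finj]; apply/countable_injP; exists (f \o val).
move=> x y _ _ /= /finj; rewrite !inE => /(_ (set_val_in _) (set_val_in _)).
exact: val_inj.
Qed.

Lemma countable_val M : countable (val @` M).
Proof.
apply: sub_countable cY; apply: subset_card_le => _ [x _ <-]; exact: set_val_in.
Qed.

Lemma subspace_tychonoff : tychonoff_space Y.
Proof.
split; last exact: uniform_completely_regular.
move=> x y cxy; apply: val_inj; apply: (@cube_hausdorff R nat) => A B xA yB.
have [z [Az Bz]] := cxy _ _ (set_val_cont xA) (set_val_cont yB).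
by exists (val z).
Qed.

Lemma subspace_extremally_disconnected : extremally_disconnected Y.
Proof.
move=> U oU; pose V := ~` closure U.
have oV : open V by apply: closed_openC; exact: closed_closure.
have UV : val @` U `&` closure (val @` V) = set0.
  rewrite -subset0 => _ [[x Ux <-]] /subtype_closure /(_ _ (open_nbhs_nbhs (conj oU Ux))).
  by move=> [y [Vy Uy]]; apply: Vy; exact: subset_closure.
have VU : closure (val @` U) `&` val @` V = set0.
  by rewrite -subset0 => z [clx [x Vx xz]]; apply: Vx; apply/subtype_closure; rewrite xz.
have bv M : val @` M `<=` cech_stone R nat.
  by move=> _ [x _ <-]; apply: bY; exact: set_val_in.
have [W [UW VW]] := separate_countable (bv U) (bv V) (countable_val U) (countable_val V) UV VU.
rewrite -[closure U]setCK openC => x clx Ux.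
have clW (N : set cube) Z z : N `<=` trace_closure R Z -> closure N z -> trace_closure R Z z.
  by move=> /closureS NZ /NZ /closed_closure.
apply: (@trace_closureC R nat W (val x) (clopen_nat W)).
  by apply: (clW _ _ (val x) UW); apply/subtype_closure.
by apply: (clW _ _ (val x) VW); apply/subtype_closure.
Qed.

Lemma clopen_trace (Z : set nat) : clopen (val @^-1` (trace_closure R Z)).
Proof.
have cl N : closed (val @^-1` (trace_closure R N)).
  apply: (continuous_closedP val).1; [exact: set_val_cont|exact: closed_closure].
split; last exact: cl.
rewrite -[X in open X]setCK openC.
rewrite (_ : ~` _ = val @^-1` (trace_closure R (~` Z))) //.
apply/seteqP; split => x /=.
  by have [//|] := trace_closure_cover Z (bY (set_val_in x)).
by move=> zC zZ; exact: trace_closureC (clopen_nat Z) zZ zC.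
Qed.

Section Over.
Notation eY := (cech_stone_map R Y).
Implicit Types c : prod_topology (fun _ : unit_function R Y => R).

(** The point [c] is sent to [z] by the canonical map from the compactification of
    [Y] to the closure of [Y]. *)
Definition lies_over c (z : cube) := forall Z : set nat,
  trace_closure R Z z -> trace_closure R (val @^-1` (trace_closure R Z)) c.

Lemma lies_over_closure c z M : cech_stone R nat z -> lies_over c z ->
  trace_closure R M c -> closure (val @` M) z.
Proof.
move=> bz cz Mc B zB; have [Z [_ Zz ZB]] := trace_closure_nbhs (@extremally_disconnected_nat) bz zB.
have := trace_closureI (clopen_trace Z) Mc (cz Z Zz).
have [->|/set0P[x [Mx Zx]] _] := eqVneq (M `&` (val @^-1` trace_closure R Z)) set0.
  by rewrite trace_closure0.
by exists (val x); split; [exists x|exact: ZB].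
Qed.

Lemma point_above z : cech_stone R nat z -> closure Y z ->
  exists c, cech_stone R Y c /\ lies_over c z.
Proof.
move=> bz Yz; have Fz := trace_ultrafilter bz.
have [|c [bc Fc]] := @trace_closure_compact R Y (filter_from [set Z | trace_closure R Z z]
    (fun Z => val @^-1` (trace_closure R Z))).
  apply: filter_from_proper.
    apply: filter_from_filter.
      by exists setT; exact: (filterT : [set Z | trace_closure R Z z] setT).
    move=> Z Z' zZ zZ'; exists (Z `&` Z').
      exact: (filterI (F := [set Z | trace_closure R Z z])).
    by move=> x /= h; split; apply: trace_closureS h => m [].
  move=> Z zZ; have zN : nbhs z (~` trace_closure R (~` Z)).
    apply: open_nbhs_nbhs; split; first by apply: closed_openC; exact: closed_closure.
    exact: trace_closureC (clopen_nat Z) zZ.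
  have [y [Yy Ny]] := Yz _ zN; have [x xy] := set_val_surj Yy.
  exists x => /=; rewrite xy.
  by have [] := trace_closure_cover Z (bY Yy).
by exists c; split => // Z zZ; apply: Fc; exists Z.
Qed.

Lemma point_below c : Y `<=` cech_stone_remainder R nat ->
  cech_stone R Y c -> exists z, cech_stone_remainder R nat z /\ lies_over c z.
Proof.
move=> rY bc.
have [|||z [rz zP]] := @free_ultrafilter_point R
    [set Z | trace_closure R (val @^-1` (trace_closure R Z)) c].
- apply: Build_ProperFilter_ex.
    move=> Z /=.
    have [->|/set0P[x /= Zx] _] := eqVneq (val @^-1` trace_closure R Z) set0.
      by rewrite trace_closure0.
    have Fx := trace_ultrafilter (bY (set_val_in x)).
    exact: (filter_ex (Zx : [set Z | trace_closure R Z (val x)] Z)).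
  split => /=.
  + rewrite (_ : val @^-1` _ = setT) //; apply/seteqP; split => // x _.
    exact: (bY (set_val_in x)).
  + move=> Z Z' Zc Z'c; apply: trace_closureS (trace_closureI (clopen_trace Z') Zc Z'c).
    by move=> x [h h']; apply: trace_closureI => //; exact: clopen_nat.
  + by move=> Z Z' ZZ'; apply: trace_closureS => x /=; exact: trace_closureS.
- move=> Z /=; apply: trace_closureU; rewrite (_ : _ `|` _ = setT) //.
  apply/seteqP; split => // x _; exact: trace_closure_cover (bY (set_val_in x)).
- move=> Z fZ /=; rewrite (_ : val @^-1` _ = setT) //; apply/seteqP; split => // x _.
  exact: remainder_cofinite (rY _ (set_val_in x)) fZ.
by exists z; split => // Z /zP.
Qed.

Lemma lies_over_point c x : cech_stone R Y c -> lies_over c (val x) -> c = eY x.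
Proof.
move=> bc cx; apply: contrapT => cex.
have [W [clW Wc Wx]] := trace_separated subspace_extremally_disconnected bc cex.
have clc : closure (val @` W) (val x).
  by apply: lies_over_closure cx Wc; apply: bY; exact: set_val_in.
apply: Wx; apply: mem_trace_closure.
by move/subtype_closure: clc; exact: clW.2.
Qed.

End Over.
End SubspaceOfOmegaStar.

(** * From a lonely point to a remote point *)

Section RemoteFromLonely.
Variables (R : realType) (p : prod_topology (fun _ : unit_function R nat => R)).
Notation rem := (cech_stone_remainder R nat).
Hypothesis lp : lonely rem p.

(** The third clause of loneliness is applied throughout in this form. *)
Lemma lonely_disjoint A B : A `<=` rem -> B `<=` rem -> countable A -> countable B ->
  limit_point A p -> limit_point B p -> A `&` B !=set0.
Proof.
move=> Ar Br cA cB lA lB; have [_ _ _ h] := lp.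
by have [y [_ ? _]] := h A B Ar Br cA cB lA lB _ filterT; exists y.
Qed.

(** A crowded countable set accumulating at [p] can be shrunk to an OHI one: the
    resolvable part of Hewitt's decomposition does not accumulate at [p], since it
    would do so through two disjoint sets. *)
Lemma lonely_ohi_subspace : exists Y, [/\ Y `<=` rem, countable Y, ~ Y p,
  limit_point Y p & open_hereditarily_irresolvable Y].
Proof.
have [_ _ [A0 [A0r cA0 crA0 lA0]] _] := lp.
pose A := A0 `&` ~` [set p].
have hT : hausdorff_space (prod_topology (fun _ : unit_function R nat => R)).
  exact: cube_hausdorff.
have op : open (~` [set p]).
  by apply: closed_openC; exact: (accessible_closed_set1 (hausdorff_accessible hT)).
have crA : crowded A := crowdedI op crA0.
have lA : limit_point A p.
  move=> U /lA0[y [yp Ay Uy]]; exists y; split => //; split => //.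
  exact/eqP.
have [D1 [D2 [D12 D21 D0 DA Dmax]]] := maximal_resolvable A.
have Ar : A `<=` rem by move=> z [/A0r].
have cA : countable A by apply: sub_countable cA0; apply: subset_card_le => z [].
have cDA D : D `<=` A -> countable D.
  by move=> DD; apply: sub_countable cA; exact: subset_card_le.
have D1A : D1 `<=` A by apply: subset_trans DA; exact: subsetUl.
have D2A : D2 `<=` A by apply: subset_trans DA; exact: subsetUr.
have nA : ~ A p by move=> [_]; apply.
have pD12 : closure D1 p -> closure D2 p -> False.
  move=> p1 p2.
  have := lonely_disjoint (subset_trans D1A Ar) (subset_trans D2A Ar)
    (cDA _ D1A) (cDA _ D2A) (closure_limit_point_notin p1 (fun h => nA (D1A _ h)))
    (closure_limit_point_notin p2 (fun h => nA (D2A _ h))).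
  by rewrite D0 => -[].
have pD1 : ~ closure D1 p.
  by move=> p1; apply: (pD12 p1); exact: closed_closure (closureS D12 p1).
have pD2 : ~ closure D2 p.
  by move=> p2; apply: (pD12 _ p2); exact: closed_closure (closureS D21 p2).
pose G := ~` (closure D1 `|` closure D2).
have oG : open G by apply: closed_openC; apply: closedU; exact: closed_closure.
pose Y := A `&` G.
have Yr : Y `<=` rem by move=> z [/Ar].
exists Y; split => //.
- by apply: cDA => z [].
- by move=> [/nA].
- move=> U pU; have pG : nbhs p G by apply: open_nbhs_nbhs; split => // -[].
  have [y [yp Ay [Uy Gy]]] := lA _ (filterI pU pG).
  by exists y.
have crY : crowded [set: Y] by apply: subtype_crowded; exact: crowdedI.
split => // U oU [x Ux]; split; first by rewrite -(setTI U); exact: crowdedI.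
move=> [B1 [B2 [[B1U UB1] [B2U UB2] B0]]].
have vcl M N : M `<=` closure N -> @set_val _ Y @` M `<=` closure (@set_val _ Y @` N).
  by move=> MN _ [z /MN Mz <-]; apply/subtype_closure.
suff : @set_val _ Y @` B1 `|` @set_val _ Y @` B2 = set0.
  have [y [B1y _]] := UB1 _ Ux _ filterT.
  by move/seteqP => [+ _]; apply; left; exists y.
apply: Dmax.
- by apply: vcl; exact: subset_trans UB2.
- by apply: vcl; exact: subset_trans UB1.
- rewrite -subset0 => _ [[y By <-] [z Bz /val_inj zy]].
  have : (B1 `&` B2) y by split => //; rewrite -zy.
  by rewrite B0.
- have h (y : Y) : (A `\` (D1 `|` D2)) (set_val y).
    have [Ay Gy] := set_val_in y; split => // Dy; apply: Gy.
    by case: Dy => Dy; [left|right]; exact: subset_closure.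
  by move=> _ [[y _ <-]|[y _ <-]].
Qed.

(** Every failure of the conclusion yields two disjoint countable sets that
    accumulate at [p]: a nowhere dense subset of [Y] and its complement, or [Y] and
    the image of a countable subset of its remainder, or, to see that [q] is the only
    point above [p], two complementary clopen subsets of [Y]. *)
Lemma remote_of_lonely : exists X : topologicalType,
  [/\ tychonoff_space X, countable [set: X], extremally_disconnected X,
      open_hereditarily_irresolvable X
    & exists q, remote_point q /\ weak_P_point (cech_stone_remainder R X) q].
Proof.
have [Y [Yr cY Yp lY ohiY]] := lonely_ohi_subspace.
have [rp _ _ _] := lp; have bp : cech_stone R nat p by case: rp.
have bY : Y `<=` cech_stone R nat by move=> z /Yr[].
have edY := subspace_extremally_disconnected bY cY.
have tY := @subspace_tychonoff R Y.
exists Y; split => //; first exact: subspace_countable.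
have [q [bq qp]] := point_above bY bp (subset_limit_point lY).
pose v := @set_val _ Y.
have meet (c c' : prod_topology (fun _ : unit_function R Y => R)) (M M' : set Y) :
    lies_over c p -> trace_closure R M c -> lies_over c' p ->
    trace_closure R M' c' -> M `&` M' !=set0.
  have lim d N : lies_over d p -> trace_closure R N d -> limit_point (v @` N) p.
    move=> dp Nd; apply: closure_limit_point_notin.
      exact: lies_over_closure bY d p N bp dp Nd.
    by move=> [x _ xp]; apply: Yp; rewrite -xp; exact: set_val_in.
  move=> cp Mc c'p Mc'.
  have vr N : v @` N `<=` rem by move=> _ [x _ <-]; apply: Yr; exact: set_val_in.
  have [_ [[x Mx <-] [y My /val_inj yx]]] := lonely_disjoint (vr M) (vr M')
    (countable_val cY M) (countable_val cY M') (lim _ _ cp Mc) (lim _ _ c'p Mc').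
  by exists x; split => //; rewrite -yx.
have rq : cech_stone_remainder R Y q.
  split => // -[x _ xq].
  have : trace_closure R [set x] q by rewrite -xq; exact: mem_trace_closure.
  move=> /(lies_over_closure bY bp qp); rewrite image_set1 -(closure_id _).1.
    by move=> px; apply: Yp; rewrite px; exact: set_val_in.
  apply: accessible_closed_set1; apply: hausdorff_accessible; exact: cube_hausdorff.
exists q; split.
  split => // N nN /subset_limit_point Nq.
  have : trace_closure R (~` N) q.
    apply: trace_closure_closure; apply: trace_closureS bq => x _ B xB.
    apply: contrapT => /nonemptyPn NB.
    suff : (closure N)° x by rewrite nN.
    apply: filterS xB => y By; apply: subset_closure; apply: contrapT => Ny.
    by have : (~` N `&` B) y by []; rewrite NB.
  by move=> /(meet _ _ _ _ qp Nq qp); rewrite setICr => -[].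
split => // C Cr cC lC.
have /choice[pi piP] : forall c, exists z, C c -> rem z /\ lies_over c z.
  move=> c; have [Cc|nC] := pselect (C c); last by exists p.
  by have [z Hz] := point_below bY Yr (Cr _ Cc).1; exists z.
have piY c : C c -> ~ Y (pi c).
  move=> Cc /set_val_surj[x xc]; have [_ cpi] := piP c Cc.
  have [bc rc] := Cr _ Cc; apply: rc; exists x => //.
  by apply/esym; apply: (lies_over_point bY cY bc); rewrite xc.
have pip c : C c -> c <> q -> pi c <> p.
  move=> Cc cq pc; have [bc _] := Cr _ Cc.
  have [_ cp] := piP c Cc; rewrite pc in cp.
  have [W [clW Wc Wq]] := trace_separated edY bc cq.
  have [//|Wq'] := trace_closure_cover W bq.
  have [x []] := meet _ _ _ _ cp Wc qp Wq'; exact.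
have lD : limit_point (pi @` C) p.
  apply/(limit_point_trace (@extremally_disconnected_nat)) => //.
    by move=> _ [c Cc <-]; have [[]] := piP c Cc.
  move=> Z _ Zp.
  have [c [Cc cq Zc]] := (limit_point_trace edY (fun c Cc => (Cr c Cc).1) bq).1 lC _
    (clopen_trace bY Z) (qp _ Zp).
  exists (pi c); split; [by exists c|exact: pip|].
  have [[bz _] cpi] := piP c Cc.
  have [//|/cpi] := trace_closure_cover Z bz.
  rewrite (_ : _ @^-1` _ = ~` (v @^-1` trace_closure R Z)).
    by move=> /(trace_closureC (clopen_trace bY Z) Zc).
  apply/seteqP; split => x /=.
    by move=> h h'; exact: trace_closureC (clopen_nat Z) h' h.
  by have [] := trace_closure_cover Z (bY _ (set_val_in x)).
have cD : countable (pi @` C) by apply: sub_countable (card_image_le _ _) cC.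
have Dr : pi @` C `<=` rem by move=> _ [c Cc <-]; have [] := piP c Cc.
by have [_ [[c Cc <-] /(piY _ Cc)]] := lonely_disjoint Dr Yr cD cY lD lY.
Qed.

End RemoteFromLonely.

Theorem theorem3p9 (R : realType) :
  (exists p, lonely (cech_stone_remainder R nat) p) <->
  (exists X : topologicalType,
     [/\ tychonoff_space X,
         countable [set: X],
         extremally_disconnected X,
         open_hereditarily_irresolvable X
       & exists p, remote_point p /\
           weak_P_point (cech_stone_remainder R X) p]).
Proof.
split=> [[p]|[X [tX cX edX ohiX [p [remp wpp]]]]]; first exact: remote_of_lonely.
exact: lonely_of_remote tX cX edX ohiX remp wpp.
Qed.
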